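(* Let $n\ge2$ be an integer and $m=\lfloor n/2\rfloor$. For $0\le j\le m$ let $$g_{n,j}(t)=\sum_{k=0}^{m}\mathrm{Cat}_{n-k-j}\binom{n-k}{k}(t-1)^k .$$ The polynomial $g_{n,m}(t)/t$ has degree $m-1$ and satisfies $g_{n,m}(t)/t\ll g_{n,j}(t)$ for every $0\le j\le m$. Moreover, $$\bigl(g_{n,0}(t),g_{n,1}(t),\dots,g_{n,m}(t)\bigr)$$ is an interlacing sequence. Consequently, every nonzero polynomial $$\sum_{j=0}^m\lambda_j\,g_{n,j}(t),\qquad \lambda_j\ge0,$$ is real-rooted.
   Context: $\mathrm{Cat}_r=\frac1{r+1}\binom{2r}{r}$ is the $r$th Catalan number. The polynomials $g_{n,j}$ are called toric $g$-contribution polynomials. A polynomial is real-rooted if all its complex zeros are real (nonzero constants are real-rooted). For real-rooted polynomials $f,g$ with positive leading coefficients, list the zeros with multiplicity as $\alpha_1\ge\dots\ge\alpha_r$ (of $f$) and $\beta_1\ge\dots\ge\beta_s$ (of $g$). Write $f\ll g$ if $s\in\{r,r+1\}$ and $$\beta_{r+1}\le\alpha_r\le\beta_r\le\dots\le\alpha_1\le\beta_1,$$ where the leftmost term is omitted when $s=r$; for $r=0$ only the degree condition $s\in\{0,1\}$ remains. An interlacing sequence is a sequence $(f_0,\dots,f_m)$ such that $f_i\ll f_j$ whenever $i<j$. *)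

(* Defs.v *)
From mathcomp Require Import all_boot all_order all_algebra.
From mathcomp Require Import reals.
From mathcomp Require Import complex.

Set Implicit Arguments.
Unset Strict Implicit.
Unset Printing Implicit Defensive.

Import Order.TTheory GRing.Theory Num.Theory.
Local Open Scope ring_scope.

Definition catalan (R : realType) (r : nat) : R :=
  r.+1%:R^-1 * 'C(2 * r, r)%:R.

(* Only used for j <= n./2; then k + j <= n for all k <= n./2, so the
   subtractions in nat do not truncate. *)
Definition toric_g (R : realType) (n j : nat) : {poly R} :=
  \sum_(k < n./2.+1)
    (catalan R (n - k - j) * 'C(n - k, k)%:R) *: ('X - 1) ^+ k.

(* Nonzero constants are real-rooted; the zero polynomial is not, since every
   complex number is one of its roots. *)
Definition real_rooted (R : realType) (p : {poly R}) : Prop :=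
  forall z : R[i], root (map_poly (real_complex R) p) z -> complex.Im z = 0.

(* The real zeros of p (nonzero), with multiplicity, in weakly decreasing
   order; for real-rooted p these are all the complex zeros. *)
Definition zero_list (R : realType) (p : {poly R}) (s : seq R) : Prop :=
  sorted >=%R s /\ (forall x : R, count_mem x s = mup x p).

(* Lists are indexed from 0: a`_i is alpha_(i+1) and b`_i is beta_(i+1).  The
   term beta_(r+1) <= alpha_r occurs exactly when size b = r + 1 and r > 0. *)
Definition interlaces (R : realType) (f g : {poly R}) : Prop :=
  [/\ real_rooted f, real_rooted g, 0 < lead_coef f, 0 < lead_coef g &
    exists a b : seq R,
      [/\ zero_list f a, zero_list g b,
          size b = size a \/ size b = (size a).+1,
          (forall i, (i < size a)%N -> a`_i <= b`_i) &
          (forall i, (i < size a)%N -> (i.+1 < size b)%N -> b`_i.+1 <= a`_i)]].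

Definition interlacing_sequence (R : realType) (fs : seq {poly R}) : Prop :=
  forall i j, (i < j)%N -> (j < size fs)%N -> interlaces fs`_i fs`_j.

(* Main.v *)
(** Put u = t - 1 and m = floor(n/2).  Up to a positive factor, the coefficient
    of u^k in g_(n,j), 1 <= j <= m, is binom(m,k) times the product of c - k over
    the m - 1 numbers c = n - m + 1/2 + l (l < m - j) and n - m + 2 + l
    (m - j <= l < m - 1).  Hence g_(n,j) is obtained from t^m by commuting
    operators c - u d/du with c > m.  Each of them turns one of the zeros at 0
    into a negative zero and interlaces, and raising a single c moves every
    negative zero to the right, because the polynomial changes by a multiple of
    a common interlacing one.  Since the parameters of g_(n,j) increase with j,
    so do the zeros.

    For j = 0 the parameters are n - m + 1/2 + l (l < m) and the coefficients
    are divided by n + 1 - k, so that t^m is replaced by its preimage under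
    n + 1 - u d/du.  This preimage is not real-rooted, but the operators
    c - u d/du still add one sign alternation on t <= 0 each.

    To close up the cycle one needs that the (k+1)-st zero of g_(n,m) is smaller
    than the k-th zero of g_(n,0).  The derivative of g_(n,m) is, up to a factor,
    the polynomial of degree m - 1 with parameters n - m + 1 + l (l < m - 1), that
    is, m - u d/du applied to the degree m polynomial with these parameters;
    raising m to n - m + 1/2 and then all parameters to n - m + 1/2 + l (l < m)
    leads to (n + 1 - u d/du) g_(n,0), whose zeros are to the left of those
    of g_(n,0). *)

Require Import Defs.
From mathcomp Require Import all_boot all_order all_algebra.
From mathcomp Require Import reals.
From mathcomp Require Import complex.
From mathcomp Require Import polyrcf ring lra zify.

Set Implicit Arguments.
Unset Strict Implicit.
Unset Printing Implicit Defensive.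

Import Order.TTheory GRing.Theory Num.Theory.
Local Open Scope ring_scope.

(** * Real polynomials with prescribed sign alternations *)

Definition rpoly (R : rcfType) (s : seq R) : {poly R} :=
  \prod_(x <- s) ('X - x%:P).

Lemma seq_choice (T : Type) (x0 : T) (N : nat) (Q : nat -> T -> Prop) :
  (forall k, (k < N)%N -> exists x, Q k x) ->
  exists2 s : seq T, size s = N & forall k, (k < N)%N -> Q k (nth x0 s k).
Proof.
elim: N => [|N IH] HQ; first by exists [::].
have [k kN|s sN Hs] := IH; first by apply: HQ; apply: ltnW.
have [x Qx] := HQ _ (ltnSn N).
exists (rcons s x); first by rewrite size_rcons sN.
move=> k; rewrite ltnS nth_rcons sN leq_eqVlt => /orP[/eqP->|ks].
  by rewrite ltnn eqxx.
by rewrite ks; apply: Hs.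
Qed.

Lemma sorted_gt_nth (R : rcfType) (s : seq R) (i j : nat) :
  sorted >%R s -> (i < j)%N -> (j < size s)%N -> s`_j < s`_i.
Proof.
move=> ss ij js.
by apply: (sorted_ltn_nth (rev_trans lt_trans) 0 ss) => //; rewrite inE ?(ltn_trans ij).
Qed.

Lemma sorted_gt_mkP (R : rcfType) (s : seq R) :
  (forall i, (i.+1 < size s)%N -> s`_i.+1 < s`_i) -> sorted >%R s.
Proof. by move=> H; apply/(sortedP 0) => i /H. Qed.

Lemma rpoly_cons (R : rcfType) (x : R) (s : seq R) :
  rpoly (x :: s) = ('X - x%:P) * rpoly s.
Proof. by rewrite /rpoly big_cons. Qed.

Lemma rpoly_monic (R : rcfType) (s : seq R) : rpoly s \is monic.
Proof. exact: monic_prod_XsubC. Qed.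

Lemma size_rpoly (R : rcfType) (s : seq R) : size (rpoly s) = (size s).+1.
Proof. exact: size_prod_XsubC. Qed.

Lemma root_rpoly (R : rcfType) (s : seq R) (x : R) :
  root (rpoly s) x = (x \in s).
Proof. exact: root_prod_XsubC. Qed.

Lemma rpoly_nth (R : rcfType) (s : seq R) (k : nat) :
  (k < size s)%N -> (rpoly s).[s`_k] = 0.
Proof. by move=> ks; apply/eqP; rewrite -/(root _ _) root_rpoly mem_nth. Qed.

Lemma rpoly_inj_sorted (R : rcfType) (s s' : seq R) :
  sorted >%R s -> sorted >%R s' -> rpoly s = rpoly s' -> s = s'.
Proof.
move=> ss ss' E.
apply: (irr_sorted_eq (rev_trans lt_trans) _ ss ss') => [x|x].
  exact: ltxx.
by rewrite -!root_rpoly E.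
Qed.

Lemma rpoly_sgn (R : rcfType) (s : seq R) (k : nat) (y : R) :
  (k <= size s)%N ->
  (forall i, (i < k)%N -> y < s`_i) ->
  (forall i, (k <= i < size s)%N -> s`_i < y) ->
  0 < (-1) ^+ k * (rpoly s).[y].
Proof.
elim: s k => [|x s IH] [|k] //= ks lo hi.
- by rewrite /rpoly big_nil hornerC mulr1.
- rewrite rpoly_cons hornerM hornerXsubC mulrCA mulr_gt0 ?subr_gt0 //.
    exact: (hi 0%N).
  by apply: IH => // i si; apply: (hi i.+1).
- rewrite rpoly_cons hornerM hornerXsubC exprS.
  have -> : -1 * (-1) ^+ k * ((y - x) * (rpoly s).[y]) =
    (x - y) * ((-1) ^+ k * (rpoly s).[y]) by ring.
  rewrite mulr_gt0 ?subr_gt0 //; first exact: (lo 0%N).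
  by apply: IH => // i si; [apply: (lo i.+1)|apply: (hi i.+1)].
Qed.

Lemma rpoly_sgn_sorted (R : rcfType) (s : seq R) (k : nat) (y : R) :
  sorted >%R s -> (k <= size s)%N ->
  ((0 < k)%N -> y < s`_k.-1) -> ((k < size s)%N -> s`_k < y) ->
  0 < (-1) ^+ k * (rpoly s).[y].
Proof.
move=> ss ks lo hi; apply: rpoly_sgn => // [i ik|i /andP[ki si]].
  have k0 : (0 < k)%N by case: (k) ik.
  move: (ik); rewrite -{1}(prednK k0) ltnS leq_eqVlt => /orP[/eqP->|ik'].
    exact: lo.
  by apply: lt_trans (lo k0) _; apply: sorted_gt_nth => //; rewrite prednK.
move: ki; rewrite leq_eqVlt => /orP[/eqP E|ki]; first by rewrite -E; apply: hi; rewrite E.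
apply: lt_trans (hi (ltn_trans ki si)); exact: sorted_gt_nth.
Qed.

Lemma rpoly_deriv_sgn (R : rcfType) (s : seq R) (k : nat) :
  sorted >%R s -> (k < size s)%N -> 0 < (-1) ^+ k * (rpoly s)^`().[s`_k].
Proof.
elim: s k => [|x s IH] k //= ss ks.
have s0 := path_sorted ss.
rewrite rpoly_cons derivM derivXsubC mul1r hornerD hornerM hornerXsubC.
case: k ks => [|k] ks /=.
  rewrite subrr mul0r addr0; apply: rpoly_sgn => // i /= si.
  exact: (@sorted_gt_nth _ (x :: s) 0 i.+1).
rewrite rpoly_nth // add0r exprS.
have -> : -1 * (-1) ^+ k * ((s`_k - x) * (rpoly s)^`().[s`_k]) =
    (x - s`_k) * ((-1) ^+ k * (rpoly s)^`().[s`_k]) by ring.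
rewrite mulr_gt0 ?subr_gt0 ?IH //.
exact: (@sorted_gt_nth _ (x :: s) 0 k.+1).
Qed.

(** The intermediate value theorem puts a zero between any two consecutive points. The strict signs
    at the points of index at least 1 keep it off the left endpoint, so the [N] zeros are distinct
    and exhaust the degree. At the largest point a weak sign suffices, so that this point may itself
    be a zero. *)
Lemma alternating_roots (R : rcfType) (p : {poly R}) (x : seq R) (N : nat) :
  size p = N.+1 -> size x = N.+1 -> sorted >%R x -> 0 <= p.[x`_0] ->
  (forall k, (0 < k <= N)%N -> 0 < (-1) ^+ k * p.[x`_k]) ->
  exists s, [/\ size s = N, sorted >%R s,
    forall k, (k < N)%N -> x`_k.+1 < s`_k <= x`_k & p = lead_coef p *: rpoly s].
Proof.
move=> sp sx xs x0 xk.
have xk' k : (k <= N)%N -> 0 <= (-1) ^+ k * p.[x`_k].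
  by case: k => [|k] kN; [rewrite mul1r|rewrite ltW // xk].
have [k kN|s sN Hs] := @seq_choice R 0 N
    (fun k r => x`_k.+1 < r <= x`_k /\ root p r).
  have xlt : x`_k.+1 < x`_k by apply: sorted_gt_nth; rewrite ?sx.
  have h1 := xk k.+1 kN; have h2 := xk' k (ltnW kN).
  have [||r] := @polyrcf.poly_ivt _ p x`_k.+1 x`_k; first exact: ltW.
    have -> : p.[x`_k.+1] * p.[x`_k] =
        - ((-1) ^+ k.+1 * p.[x`_k.+1] * ((-1) ^+ k * p.[x`_k])).
      rewrite -[LHS](signrMK k) exprS; ring.
    by rewrite oppr_le0 mulr_ge0 // ltW.
  rewrite in_itv /= => /andP[r1 r2] pr; exists r; split=> //.
  rewrite r2 lt_neqAle r1 !andbT; apply/eqP=> E; move: h1.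
  by rewrite E (rootP pr) mulr0 ltxx.
have ss : sorted >%R s.
  apply: sorted_gt_mkP => i; rewrite sN => iN.
  have [/andP[_ a] _] := Hs _ iN; have [/andP[b _] _] := Hs _ (ltnW iN).
  exact: le_lt_trans b.
exists s; split=> // [k /Hs[]//|].
apply: all_roots_prod_XsubC; first by rewrite sN.
  by apply/(all_nthP 0) => i; rewrite sN => /Hs[].
rewrite uniq_rootsE; apply: (sorted_uniq (rev_trans lt_trans) _ ss) => y.
exact: ltxx.
Qed.

Lemma horner_minfty (R : rcfType) (p : {poly R}) (N : nat) (y : R) :
  size p = N.+1 -> 0 < lead_coef p -> exists2 x, x < y & 0 < (-1) ^+ N * p.[x].
Proof.
(* The reflection of t to -t, with the factor (-1)^N, keeps the leading coefficient and reduces the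
   claim to the behaviour at plus infinity. *)
move=> sp lp; pose q := (-1) ^+ N *: (p \Po (- 'X)).
have sX : size (- 'X : {poly R}) = 2%N by rewrite size_polyN size_polyX.
have lq : lead_coef q = lead_coef p.
  rewrite lead_coefZ lead_coef_comp ?sX // lead_coefN lead_coefX sp /=.
  by rewrite mulrCA -exprMn mulrNN mulr1 expr1n mulr1.
have [n Hn] : exists n, forall x, x >= n -> q.[x] >= lead_coef q.
  by apply: poly_pinfty_gt_lc; rewrite lq.
exists (- (`|n| + `|y| + 1)).
  have := ler_norm (- y); rewrite normrN => h; have := normr_ge0 n; lra.
have := Hn (`|n| + `|y| + 1); rewrite lq /q hornerZ horner_comp hornerN hornerX.
move=> H; apply: lt_le_trans lp (H _).
have := ler_norm n; have := normr_ge0 y; lra.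
Qed.

(** The missing last sample point is taken far to the left, where degree and leading coefficient
    force the sign (-1)^N. *)
Lemma alternating_roots_minfty (R : rcfType) (p : {poly R}) (x : seq R) (N : nat) :
  size p = N.+1 -> 0 < lead_coef p -> size x = N -> sorted >%R x ->
  ((0 < N)%N -> 0 <= p.[x`_0]) ->
  (forall k, (0 < k < N)%N -> 0 < (-1) ^+ k * p.[x`_k]) ->
  exists s, [/\ size s = N, sorted >%R s,
    forall k, (k < N)%N -> s`_k <= x`_k /\ ((k.+1 < N)%N -> x`_k.+1 < s`_k) &
    p = lead_coef p *: rpoly s].
Proof.
move=> sp lp sx xs x0 xk.
have [y yx py] := horner_minfty (last 0 x) sp lp.
have [||||s [sN ss Hs E]] := @alternating_roots _ p (rcons x y) N sp.
- by rewrite size_rcons sx.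
- apply: sorted_gt_mkP => i; rewrite size_rcons ltnS sx !nth_rcons sx => iN.
  rewrite iN; move: (iN); rewrite leq_eqVlt => /orP[/eqP iE|iN'].
    rewrite iE ltnn eqxx; apply: lt_le_trans yx _.
    by rewrite -nth_last sx -iE.
  by rewrite iN'; apply: sorted_gt_nth; rewrite ?sx.
- rewrite nth_rcons sx; case: ltnP => [/x0//|]; rewrite leqn0 => /eqP N0.
  by move: py; rewrite N0 mul1r eqxx => /ltW.
- move=> k /andP[k0]; rewrite nth_rcons sx leq_eqVlt => /orP[/eqP->|kN].
    by rewrite ltnn eqxx.
  by rewrite kN; apply: xk; rewrite k0.
exists s; split=> // k kN; have /andP[] := Hs _ kN.
rewrite !nth_rcons sx kN => a b; split=> // kN'; by rewrite kN' in a.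
Qed.

Lemma alternating_roots_strict (R : rcfType) (p : {poly R}) (x : seq R) (N : nat) :
  size p = N.+1 -> 0 < lead_coef p -> size x = N -> sorted >%R x ->
  (forall k, (k < N)%N -> 0 < (-1) ^+ k * p.[x`_k]) ->
  exists s, [/\ size s = N, sorted >%R s,
    forall k, (k < N)%N -> s`_k < x`_k /\ ((k.+1 < N)%N -> x`_k.+1 < s`_k) &
    p = lead_coef p *: rpoly s].
Proof.
move=> sp lp sx xs xk.
have [|k /andP[_]|s [sN ss Hs E]] :=
  alternating_roots_minfty sp lp sx xs; last 2 first.
- exact: xk.
- exists s; split=> // k kN; have [a b] := Hs k kN; split=> //.
  rewrite lt_neqAle a andbT; apply/eqP => sk; move: (xk _ kN).
  by rewrite -sk E hornerZ rpoly_nth ?sN // !mulr0 ltxx.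
- by move=> /xk; rewrite mul1r => /ltW.
Qed.

(** * The operators c - u d/du *)

Definition eulerop (R : rcfType) (c : R) (p : {poly R}) : {poly R} :=
  c *: p - ('X - 1) * p^`().

Lemma eulerop_horner (R : rcfType) (c : R) (p : {poly R}) (y : R) :
  (eulerop c p).[y] = c * p.[y] + (1 - y) * p^`().[y].
Proof. by rewrite /eulerop !(hornerE, hornerN); ring. Qed.

Lemma eulerop_shift (R : rcfType) (c d : R) (p : {poly R}) :
  eulerop d p = eulerop c p + (d - c) *: p.
Proof. by rewrite /eulerop -!mul_polyC polyCB; ring. Qed.

(* The operators [eulerop c], [c] in [S], applied to the sum of the
   [w k *: ('X - 1) ^+ k], on which they act diagonally. *)
Definition mulseq (R : rcfType) (w : nat -> R) (m : nat) (S : seq R) : {poly R} :=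
  \sum_(k < m.+1) (w k * \prod_(c <- S) (c - k%:R)) *: ('X - 1) ^+ k.

Lemma mulseq_cons (R : rcfType) (w : nat -> R) (m : nat) (c : R) (S : seq R) :
  mulseq w m (c :: S) = eulerop c (mulseq w m S).
Proof.
rewrite /eulerop /mulseq scaler_sumr raddf_sum /= mulr_sumr -sumrB.
apply: eq_bigr => k _; rewrite big_cons derivZ deriv_exp.
rewrite derivB derivX derivC subr0 mul1r -!mul_polyC !polyCM polyCB polyC_natr.
case: (k : nat) => [|i] /=; first by rewrite mulr0n; ring.
by rewrite -mulr_natl exprS; ring.
Qed.

Lemma mulseq_perm (R : rcfType) (w : nat -> R) (m : nat) (S S' : seq R) :
  perm_eq S S' -> mulseq w m S = mulseq w m S'.
Proof. by move=> SS; apply: eq_bigr => k _; rewrite (perm_big _ SS). Qed.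

Lemma mulseq_size_lead (R : rcfType) (w : nat -> R) (m : nat) (S : seq R) :
  w m * \prod_(c <- S) (c - m%:R) != 0 ->
  size (mulseq w m S) = m.+1 /\
  lead_coef (mulseq w m S) = w m * \prod_(c <- S) (c - m%:R).
Proof.
move=> a0; rewrite /mulseq big_ord_recr /=; set q := \sum_(_ < _) _; set p := _ *: _.
have sX k : size (('X - 1 : {poly R}) ^+ k) = k.+1 by rewrite -polyC1 size_exp_XsubC.
have sp : size p = m.+1 by rewrite size_scale.
have sq : (size q < size p)%N.
  rewrite sp ltnS; apply: (leq_trans (size_sum _ _ _)).
  apply/bigmax_leqP => i _; apply: leq_trans (size_scale_leq _ _) _.
  by rewrite sX ltn_ord.
rewrite addrC size_polyDl // lead_coefDl // sp lead_coefZ.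
by rewrite -polyC1 (eqP (monic_exp _ (monicXsubC _))) mulr1.
Qed.

(** * Negative zeros created from t^m *)

Definition wbin (R : rcfType) (m k : nat) : R := 'C(m, k)%:R.

Lemma mulseq_nil (R : rcfType) (m : nat) : mulseq (wbin R m) m [::] = 'X^m.
Proof.
rewrite -[in RHS](subrK 1 'X) addrC exprDn /mulseq; apply: eq_bigr => k _.
by rewrite big_nil mulr1 expr1n mul1r -scaler_nat.
Qed.

(** Each operator turns one of the m zeros of t^m at 0 into a negative one: [s] collects the
    negative zeros, and the power of ['X] the zeros still at 0. *)
Definition mul_roots (R : rcfType) (m : nat) (S s : seq R) : Prop :=
  [/\ size s = size S, sorted >%R s, all (fun x => x < 0) s &
    mulseq (wbin R m) m S =
    \prod_(c <- S) (c - m%:R) *: ('X^(m - size S) * rpoly s)].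

Lemma prod_sub_gt0 (R : rcfType) (x : R) (S : seq R) :
  all (fun c => x < c) S -> 0 < \prod_(c <- S) (c - x).
Proof.
move=> /allP H; rewrite big_seq; apply: prodr_gt0 => c /H; by rewrite subr_gt0.
Qed.

Lemma mul_roots_uniq (R : rcfType) (m : nat) (S s s' : seq R) :
  all (fun c => m%:R < c) S -> mul_roots m S s -> mul_roots m S s' -> s = s'.
Proof.
move=> /prod_sub_gt0 H [_ ss _ E] [_ ss' _ E']; apply: rpoly_inj_sorted => //.
have /(scalerI (lt0r_neq0 H)) := etrans (esym E) E'.
by apply: mulfI; rewrite expf_neq0 ?polyX_eq0.
Qed.

(** Once the zeros remaining at 0 are split off, the cofactor alternates in sign along 0 and the old
    negative zeros, so the new zeros interlace with these points. *)
Lemma mul_roots_cons (R : rcfType) (m : nat) (c : R) (S s : seq R) :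
  all (fun c => m%:R < c) S -> m%:R < c -> (size S < m)%N ->
  mul_roots m S s ->
  exists s', mul_roots m (c :: S) s' /\
    forall k, (k <= size S)%N ->
      s'`_k < (0 :: s)`_k /\ ((k < size S)%N -> s`_k < s'`_k).
Proof.
move=> HS Hc Sm [sS ss s0 E].
have HcS : all (fun c => m%:R < c) (c :: S) by rewrite /= Hc.
have lam := prod_sub_gt0 HS; have lam' := prod_sub_gt0 HcS.
set l := \prod_(c <- S) _ in E lam; set l' := \prod_(c0 <- c :: S) _ in lam'.
set d := (m - (size S).+1)%N; have aE : (m - size S)%N = d.+1 by rewrite subnSK.
(* [f] is the image of [l *: ('X^d.+1 * rpoly s)] under [eulerop c], divided by ['X^d]. *)
pose f := l *: (c *: ('X * rpoly s) -
  ('X - 1) * (d.+1%:R *: rpoly s + 'X * (rpoly s)^`())).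
have Ef : mulseq (wbin R m) m (c :: S) = 'X^d * f.
  rewrite mulseq_cons E aE /f /eulerop derivZ derivM derivXn /= exprS.
  rewrite -mulr_natl -!mul_polyC polyC_natr; ring.
have mE : m = (d + (size S).+1)%N by rewrite subnK.
have w1 : wbin R m m * l' = l' by rewrite /wbin binn mul1r.
have [|Esz Elc] := @mulseq_size_lead _ (wbin R m) m (c :: S).
  by rewrite -/l' w1 lt0r_neq0.
have flc : lead_coef f = l'.
  by rewrite -w1 -Elc Ef lead_coefM lead_coefXn mul1r.
have f0 : f != 0 by rewrite -lead_coef_eq0 flc lt0r_neq0.
have fsz : size f = (size S).+2.
  by move: Esz; rewrite Ef mulrC size_mulXn // [X in _ = X.+1]mE -addnS => /addnI.
have sx : sorted >%R (0 :: s).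
  by rewrite /= path_sortedE ?ss ?andbT //; exact: rev_trans lt_trans.
have [||||s' [sN ss' Hs fE]] := @alternating_roots_strict _ f (0 :: s) (size S).+1 fsz.
- by rewrite flc.
- by rewrite /= sS.
- exact: sx.
(* At 0 the value is [l * d.+1%:R * (rpoly s).[0]]; at a zero in [s] only the term with the
   derivative survives. *)
- case=> [|k] kS /=.
    rewrite mul1r /f !(hornerE, hornerN) /=.
    have r0 : 0 < (rpoly s).[0].
      have := @rpoly_sgn _ s 0 0 isT; rewrite mul1r; apply=> // i /= si.
      by apply: (allP s0); rewrite mem_nth.
    rewrite mulr0 mul0r sub0r mulN1r mulNr opprK.
    by rewrite !mulr_gt0 // ltr0n.
  have ks : (k < size s)%N by rewrite sS.
  have sk0 : s`_k < 0 by apply: (allP s0); rewrite mem_nth.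
  rewrite /f !(hornerE, hornerN) /= rpoly_nth //.
  have := rpoly_deriv_sgn ss ks; set u := (-1) ^+ k; set v := _.[_] => uv.
  rewrite exprS -/u.
  set e := (X in 0 < X); have -> : e = l * (u * v) * ((1 - s`_k) * (- s`_k)).
    rewrite /e; ring.
  have s1 : 0 < 1 - s`_k by rewrite subr_gt0 (lt_trans sk0).
  have s2 : 0 < - s`_k by rewrite oppr_gt0.
  exact: mulr_gt0 (mulr_gt0 lam uv) (mulr_gt0 s1 s2).
exists s'; split; last first.
  by move=> k kS; have [a b] := Hs k kS; split=> // kS'; apply: b.
split=> //.
  apply/(all_nthP 0) => i; rewrite sN => iS; have [a _] := Hs i iS.
  apply: lt_le_trans a _; case: i iS => // i iS /=.
  by rewrite ltW // (allP s0) // mem_nth // sS.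
by rewrite Ef [in LHS]fE flc scalerAr.
Qed.

Lemma mul_roots_exists (R : rcfType) (m : nat) (S : seq R) :
  all (fun c => m%:R < c) S -> (size S <= m)%N -> exists s, mul_roots m S s.
Proof.
elim: S => [|c S IH] /= => [_ _|/andP[Hc HS] Sm].
  by exists [::]; split; rewrite // mulseq_nil big_nil scale1r subn0 /rpoly big_nil mulr1.
have [|s Hs] := IH HS; first exact: ltnW.
by have [s' [H _]] := mul_roots_cons HS Hc Sm Hs; exists s'.
Qed.

(* The two polynomials differ by a multiple of the one with parameters [S],
   whose sign at the zeros of the first is known by interlacing. *)
Lemma mul_roots_raise (R : rcfType) (m : nat) (c c' : R) (S r r' : seq R) :
  all (fun c => m%:R < c) S -> m%:R < c -> c < c' -> (size S < m)%N ->
  mul_roots m (c :: S) r -> mul_roots m (c' :: S) r' ->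
  forall k, (k <= size S)%N -> r`_k < r'`_k.
Proof.
move=> HS Hc cc' Sm Hr Hr' k kS.
have Hc' := lt_trans Hc cc'.
have [s Hs] := mul_roots_exists HS (ltnW Sm).
have [r1 [H1 I]] := mul_roots_cons HS Hc Sm Hs.
have [r1' [H1' I']] := mul_roots_cons HS Hc' Sm Hs.
have E1 : r1 = r by apply: mul_roots_uniq H1 Hr; rewrite /= Hc.
have E1' : r1' = r' by apply: mul_roots_uniq H1' Hr'; rewrite /= Hc'.
rewrite {}E1 {H1} in I; rewrite {}E1' {H1'} in I'.
have [sr sor r0 Er] := Hr; have [sr' sor' r0' Er'] := Hr'; have [ss sos s0 Es] := Hs.
set y := r`_k; have y0 : y < 0 by apply: (allP r0); rewrite mem_nth // sr.
have := eulerop_shift c c' (mulseq (wbin R m) m S); rewrite -!mulseq_cons.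
move=> /(congr1 (fun p => p.[y])); rewrite Er Er' Es.
rewrite !(hornerD, hornerZ, hornerM, hornerXn) rpoly_nth ?sr // !mulr0 add0r /=.
set d := (m - (size S).+1)%N; have -> : (m - size S)%N = d.+1 by rewrite subnSK.
set l := \prod_(_ <- S) _; set l' := \prod_(_ <- _) _.
have l0 : 0 < l by apply: prod_sub_gt0.
have l0' : 0 < l' by apply: prod_sub_gt0; rewrite /= Hc'.
have yd : y ^+ d != 0 by rewrite expf_neq0 // lt_eqF.
rewrite mulrCA exprS (mulrC y) => E.
have {}E : l' * (rpoly r').[y] = (c' - c) * l * y * (rpoly s).[y].
  by apply: (mulfI yd); rewrite E; ring.
have sg : 0 < (-1) ^+ k * (rpoly s).[y].
  apply: rpoly_sgn_sorted => //; first by rewrite ss.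
    by move=> k0; have [+ _] := I k kS; rewrite -/y; case: (k) k0.
  by rewrite ss => kS'; have [_ /(_ kS')] := I k kS.
have neg : (-1) ^+ k * (rpoly r').[y] < 0.
  rewrite -(pmulr_rlt0 _ l0') mulrCA E.
  set a := (-1) ^+ k in sg *; set b := (rpoly s).[y] in sg *.
  have -> : a * ((c' - c) * l * y * b) = ((c' - c) * l * (a * b)) * y by ring.
  rewrite pmulr_rlt0 //; apply: mulr_gt0 sg.
  by rewrite mulr_gt0 // subr_gt0.
(* If the k-th zero in [r'] were to the left of [y], then [y] would lie between it and the preceding
   zero, which gives the opposite sign. *)
rewrite ltNge; apply/negP; rewrite le_eqVlt => /orP[/eqP r'y|r'y].
  by move: neg; rewrite -r'y rpoly_nth ?sr' // mulr0 ltxx.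
suff pos : 0 < (-1) ^+ k * (rpoly r').[y] by have := lt_trans pos neg; rewrite ltxx.
apply: rpoly_sgn_sorted => //; first by rewrite sr' ltnW.
move=> k0; have [+ _] := I k kS; rewrite -/y => /lt_trans; apply.
have kS' : (k.-1 < size S)%N by rewrite prednK.
by have [_ /(_ kS')] := I' k.-1 (ltnW kS'); case: (k) k0.
Qed.

Lemma mul_roots_perm (R : rcfType) (m : nat) (S S' s : seq R) :
  perm_eq S S' -> mul_roots m S s -> mul_roots m S' s.
Proof.
move=> SS' [sS ss s0 E]; split=> //; first by rewrite sS (perm_size SS').
by rewrite -(mulseq_perm _ _ SS') E (perm_size SS') (perm_big _ SS').
Qed.

(** The parameters are raised one at a time; [A] holds those already treated, and a permutation
    brings the next one to the front for [mul_roots_raise]. Zeros move strictly as soon as one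
    parameter does, hence the alternative [S = S']. *)
Lemma mul_roots_mono (R : rcfType) (m : nat) (A S S' r r' : seq R) :
  all (fun c => m%:R < c) (A ++ S) -> all2 <=%R S S' -> (size (A ++ S) <= m)%N ->
  mul_roots m (A ++ S) r -> mul_roots m (A ++ S') r' ->
  S = S' \/ forall k, (k < size (A ++ S))%N -> r`_k < r'`_k.
Proof.
elim: S S' A r r' => [|c S IH] [|c' S'] A r r' //=; first by left.
rewrite all_cat /= => /and3P[HA Hc HS] /andP[cc' SS'] sm Hr Hr'.
have HAS : all (fun c => m%:R < c) (A ++ S) by rewrite all_cat HA.
have sz : size (A ++ c :: S) = (size (A ++ S)).+1 by rewrite !size_cat addnS.
have Hc' := lt_le_trans Hc cc'.
have pm x T : perm_eq (A ++ x :: T) (x :: A ++ T).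
  by rewrite perm_catC /= perm_cons perm_catC.
have [r1 H1] : exists r1, mul_roots m (c' :: A ++ S) r1.
  by apply: mul_roots_exists; rewrite /= ?Hc' // -sz.
have H1' : mul_roots m (rcons A c' ++ S) r1.
  by rewrite cat_rcons; apply: mul_roots_perm H1; rewrite perm_sym pm.
have Hr'' : mul_roots m (rcons A c' ++ S') r' by rewrite cat_rcons.
have a1 : all (fun c => m%:R < c) (rcons A c' ++ S).
  by rewrite cat_rcons all_cat HA /= Hc'.
have sz1 : size (rcons A c' ++ S) = size (A ++ c :: S).
  by rewrite cat_rcons !size_cat.
have a2 : (size (rcons A c' ++ S) <= m)%N by rewrite sz1.
have Hr1 := mul_roots_perm (pm c S) Hr.
have := IH S' _ r1 r' a1 SS' a2 H1' Hr''; rewrite sz1.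
move: cc'; rewrite le_eqVlt => /orP[/eqP cE|clt].
  have E : r = r1.
    by apply: mul_roots_uniq Hr1 _; rewrite ?cE //= Hc'.
  by case=> [->|lt1]; [left; rewrite cE|right; rewrite E].
have lt0 : forall k, (k < size (A ++ c :: S))%N -> r`_k < r1`_k.
  rewrite sz => k kS; apply: (mul_roots_raise HAS Hc clt _ Hr1 H1) => //.
  by rewrite -sz.
case=> [SE|lt1]; right=> k kS; last exact: lt_trans (lt0 k kS) (lt1 k kS).
suff -> : r' = r1 by apply: lt0.
apply: mul_roots_uniq Hr'' _; last by rewrite -SE.
by rewrite -SE.
Qed.

(** * Dividing the coefficients by N - k *)

(** With no parameters these weights give the preimage of t^m under N - u d/du; for j = 0 they are
    used with N = n + 1. *)
Definition wquot (R : rcfType) (N : R) (m k : nat) : R :=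
  'C(m, k)%:R / (N - k%:R).

Lemma subr_nat_gt0 (R : rcfType) (N : R) (m k : nat) :
  m%:R < N -> (k <= m)%N -> 0 < N - k%:R.
Proof. by move=> mN km; rewrite subr_gt0 (le_lt_trans _ mN) // ler_nat. Qed.

Lemma mulseq_wquot (R : rcfType) (N : R) (m : nat) (S : seq R) :
  m%:R < N -> eulerop N (mulseq (wquot N m) m S) = mulseq (wbin R m) m S.
Proof.
move=> mN; rewrite -mulseq_cons; apply: eq_bigr => k _; congr (_ *: _).
rewrite big_cons mulrA /wquot divfK // lt0r_neq0 //.
by apply: subr_nat_gt0 mN _; rewrite -ltnS.
Qed.

(* The value at t = 0 of the preimage of t^m under N - u d/du. *)
Lemma sum_bin_quot (R : rcfType) (N : R) (m : nat) : m%:R < N ->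
  \sum_(k < m.+1) 'C(m, k)%:R / (N - k%:R) * (-1) ^+ k =
  (-1) ^+ m * m`!%:R / \prod_(k < m.+1) (N - k%:R).
Proof.
elim: m N => [|m IH] N mN.
  by rewrite !big_ord1 bin0 fact0 expr0 !mulr1 !mul1r.
have mN1 : m%:R < N - 1 by rewrite ltrBrDr natr1.
have mN0 : m%:R < N by apply: lt_trans mN; rewrite ltr_nat.
(* Pascal's rule splits the sum into two sums for [m], at [N] and at [N - 1]. *)
have H : \sum_(k < m.+2) 'C(m.+1, k)%:R / (N - k%:R) * (-1) ^+ k =
  \sum_(k < m.+1) 'C(m, k)%:R / (N - k%:R) * (-1) ^+ k -
  \sum_(k < m.+1) 'C(m, k)%:R / (N - 1 - k%:R) * (-1) ^+ k.
  have -> : \sum_(k < m.+1) 'C(m, k)%:R / (N - k%:R) * (-1) ^+ k =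
      \sum_(k < m.+2) 'C(m, k)%:R / (N - k%:R) * (-1) ^+ k.
    by rewrite [RHS]big_ord_recr /= bin_small // !mul0r addr0.
  rewrite big_ord_recl [X in _ = X - _]big_ord_recl -addrA !bin0 -sumrB.
  congr (_ + _); apply: eq_bigr => k _; rewrite /= /bump /= add1n binS natrD.
  have -> : N - 1 - k%:R = N - k.+1%:R by rewrite -natr1; ring.
  by rewrite exprS; ring.
rewrite H !IH // [X in _ = _ / X]big_ord_recl [X in _ / X - _]big_ord_recl.
rewrite [X in _ - _ / X]big_ord_recr /= subr0.
have -> : \prod_(i < m) (N - (bump 0 i)%:R) = \prod_(i < m) (N - 1 - i%:R).
  by apply: eq_bigr => i _; rewrite /bump add1n -natr1; ring.
have -> : \prod_(i < m.+1) (N - (bump 0 i)%:R) =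
    \prod_(i < m) (N - 1 - i%:R) * (N - 1 - m%:R).
  rewrite big_ord_recr /= /bump add1n -natr1; congr (_ * _); last by ring.
  by apply: eq_bigr => i _; rewrite /bump add1n -natr1; ring.
set Q := \prod_(i < m) _.
have Q0 : Q != 0.
  rewrite lt0r_neq0 //; apply: prodr_gt0 => i _.
  by apply: subr_nat_gt0 mN1 _; apply: ltnW.
have N0 : N != 0 by rewrite lt0r_neq0 // (le_lt_trans _ mN) // ler0n.
have M0 : N - 1 - m%:R != 0 by rewrite lt0r_neq0 // subr_gt0.
rewrite factS natrM exprS -natr1.
by field; rewrite N0 Q0 M0.
Qed.

(* Apart from a positive factor, the operator is the derivative of
   q / (1 - t)^b. *)
Lemma euler_rolle_pos (R : rcfType) (q : {poly R}) (b x x' : R) :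
  0 < b -> x' < x -> x <= 0 -> q.[x'] < 0 -> 0 < q.[x] ->
  exists2 y, x' < y < x & 0 < (eulerop b q).[y].
Proof.
move=> b0 xx x0 qx' qx.
(* With [r] the last zero before [x], [q] is positive between [r] and [x], and the mean value
   theorem yields a point there where [q] and its derivative are both positive. *)
have [r [r1 r2 qr Hr]] : exists r, [/\ x' < r, r < x, q.[r] = 0 &
    forall z, r < z < x -> 0 < q.[z]].
  have rt : forall r, {in `]r, x[, forall z, ~~ root q z} ->
      forall z, r < z < x -> 0 < q.[z].
    move=> r Hr z /andP[z1 z2]; rewrite ltNge; apply/negP => qz.
    have [|y] := @polyrcf.poly_ivt _ q z x (ltW z2).
      by rewrite mulr_le0_ge0 // ltW.
    rewrite in_itv /= => /andP[y1 y2] qy.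
    have yx : y < x.
      by rewrite lt_neqAle y2 andbT; apply/eqP=> E; move: qx; rewrite -E (rootP qy) ltxx.
    by have := Hr y; rewrite in_itv /= yx (lt_le_trans z1 y1) qy => /(_ isT).
  case: (prev_rootP q x' x) => [q0|r _ qr|c _ _ Hc].
  - by move: qx; rewrite q0 horner0 ltxx.
  - rewrite in_itv /= => /andP[r1 r2] Hr; exists r; split=> //; exact: rt.
  have [|y] := @polyrcf.poly_ivtoo _ q x' x (ltW xx).
    by rewrite nmulr_rlt0.
  by move=> yI qy; have := Hc y yI; rewrite qy.
have [y] := poly_mvt q r2.
rewrite in_itv /= qr subr0 => /andP[y1 y2] E.
exists y; first by rewrite y2 (lt_trans r1 y1).
rewrite eulerop_horner addr_gt0 //.
  by rewrite mulr_gt0 // Hr // y1.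
rewrite mulr_gt0 //; first by rewrite subr_gt0 (lt_trans y2) // (le_lt_trans x0).
by rewrite -(pmulr_lgt0 _ (_ : 0 < x - r)) ?subr_gt0 // -E.
Qed.

Lemma euleropZ (R : rcfType) (a b : R) (q : {poly R}) :
  eulerop b (a *: q) = a *: eulerop b q.
Proof. by rewrite /eulerop derivZ -!mul_polyC; ring. Qed.

Lemma euler_rolle (R : rcfType) (q : {poly R}) (a b x x' : R) :
  0 < b -> x' < x -> x <= 0 -> a * q.[x'] < 0 -> 0 < a * q.[x] ->
  exists2 y, x' < y < x & 0 < a * (eulerop b q).[y].
Proof.
move=> b0 xx x0; rewrite -!hornerZ => h1 h2.
have [y yI] := euler_rolle_pos b0 xx x0 h1 h2.
by rewrite euleropZ hornerZ => ?; exists y.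
Qed.

(* Sign alternations, rather than roots, since the intermediate polynomials
   also have non-real roots. *)
Definition alternates (R : rcfType) (e N : nat) (q : {poly R}) : Prop :=
  exists x : seq R, [/\ size x = N.+1, sorted >%R x, x`_0 = 0 &
    forall k, (k <= N)%N -> 0 < (-1) ^+ (e + k) * q.[x`_k]].

Lemma wquot_lead_gt0 (R : rcfType) (N : R) (m : nat) (S : seq R) :
  m%:R < N -> all (fun c => m%:R < c) S ->
  0 < wquot N m m * \prod_(c <- S) (c - m%:R).
Proof.
move=> mN /prod_sub_gt0 H; rewrite mulr_gt0 //.
by rewrite /wquot binn mul1r invr_gt0 subr_gt0.
Qed.

(** The operator with parameter [c] is the one with parameter [N] plus multiplication by [c - N].
    The former restores the binomial weights, and fewer than m operators leave a zero at 0. *)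
Lemma mulseq_wquot0 (R : rcfType) (N c : R) (m : nat) (S : seq R) :
  m%:R < N -> all (fun c => m%:R < c) S -> (size S < m)%N ->
  (mulseq (wquot N m) m (c :: S)).[0] = (c - N) * (mulseq (wquot N m) m S).[0].
Proof.
move=> mN HS Sm; rewrite mulseq_cons (eulerop_shift N c) mulseq_wquot //.
have [s [_ _ _ ->]] := mul_roots_exists HS (ltnW Sm).
rewrite !(hornerD, hornerZ, hornerM, hornerXn) expr0n.
by rewrite subn_eq0 leqNgt Sm !mul0r mulr0 add0r.
Qed.

(** Induction on [S], starting from the sign of [sum_bin_quot] at 0. As [b < N], a new operator
    flips the sign at 0; [euler_rolle] gives a point between any two old ones, and a point far to
    the left completes the list. *)
Lemma mulseq_wquot_alternates (R : rcfType) (N : R) (m : nat) (S : seq R) :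
  m%:R < N -> all (fun c => m%:R < c < N) S -> (size S <= m)%N ->
  alternates (m + size S) (size S) (mulseq (wquot N m) m S).
Proof.
move=> mN; elim: S => [|b S IH] /= HS Sm.
  exists [:: 0]; split=> // k; rewrite leqn0 => /eqP->.
  rewrite !addn0 /mulseq /= horner_sum.
  under eq_bigr => i _.
    rewrite big_nil mulr1 hornerZ horner_exp !hornerE; over.
  rewrite /wquot sum_bin_quot // mulrA signrMK divr_gt0 ?ltr0n ?fact_gt0 //.
  apply: prodr_gt0 => i _; apply: subr_nat_gt0 mN _.
  by rewrite -ltnS.
have {HS} [/andP[mb bN] HS] := andP HS.
have HS' : all (fun c => m%:R < c) S.
  by apply: sub_all HS => c /andP[].
have [x [sx xs x0 Hx]] := IH HS (ltnW Sm).
set q := mulseq _ _ _ in Hx.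
have b0 : 0 < b by rewrite (le_lt_trans _ mb) // ler0n.
have xle k : (k <= size S)%N -> x`_k <= 0.
  rewrite leq_eqVlt; case: k => [_|k kS]; first by rewrite x0.
  have := sorted_gt_nth xs (ltn0Sn k); rewrite sx x0 => /(_ _)/ltW; apply.
  by rewrite ltnS leq_eqVlt.
have [k kS|y sy Hy] := @seq_choice R 0 (size S) (fun k r => x`_k.+1 < r < x`_k
    /\ 0 < (-1) ^+ (m + size S + k) * (eulerop b q).[r]).
  have xlt : x`_k.+1 < x`_k by apply: sorted_gt_nth; rewrite ?sx.
  have [|r rI Hr] := euler_rolle b0 xlt (xle _ (ltnW kS)) _ (Hx k (ltnW kS)).
    by have := Hx _ kS; rewrite addnS exprS -mulrA mulN1r oppr_gt0.
  by exists r.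
have lead0 : 0 < wquot N m m * \prod_(c <- b :: S) (c - m%:R).
  by apply: wquot_lead_gt0; rewrite //= mb.
have [szq ldq] := mulseq_size_lead (lt0r_neq0 lead0).
have ld : 0 < lead_coef (mulseq (wquot N m) m (b :: S)) by rewrite ldq.
have [z zx Hz] := horner_minfty (last 0 y) szq ld.
have ny k : (k < size S)%N -> (rcons y z)`_k = y`_k by rewrite nth_rcons sy => ->.
have nz : (rcons y z)`_(size S) = z by rewrite nth_rcons sy ltnn eqxx.
exists (0 :: rcons y z); split=> //=.
- by rewrite size_rcons sy.
- apply: (@sorted_gt_mkP _ (0 :: rcons y z)) => -[|i]; rewrite /= size_rcons sy !ltnS.
    case: (posnP (size S)) => [S0 _|S0 _].
      by rewrite -{1}S0 nz; move: sy zx; rewrite S0 => /size0nil->.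
    rewrite ny //; have [/andP[_ h] _] := Hy _ S0; exact: lt_le_trans h (xle _ _).
  move=> iS; rewrite (ny i) //; move: (iS); rewrite leq_eqVlt => /orP[/eqP E|iS'].
    rewrite E nz; move: zx; rewrite (last_nth 0) sy -E; exact.
  rewrite ny //; have [/andP[_ h] _] := Hy _ iS'; have [/andP[h' _] _] := Hy _ iS.
  exact: lt_trans h h'.
case=> [|k] kS /=.
  rewrite mulseq_wquot0 // -/q addn0 addnS exprS.
  have := Hx 0 (leq0n _); rewrite x0 addn0 => Hx0.
  have -> : forall u v, -1 * u * ((b - N) * v) = (N - b) * (u * v) :> R.
    by move=> u v; ring.
  by rewrite mulr_gt0 // subr_gt0.
have -> : (-1) ^+ (m + (size S).+1 + k.+1) = (-1) ^+ (m + size S + k) :> R.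
  by rewrite !addnS addSn !exprS; ring.
move: kS; rewrite ltnS leq_eqVlt => /orP[/eqP->|kS].
  rewrite nz -addnA exprD addnn -mul2n exprM expr2 mulrNN mulr1 expr1n mulr1.
  by rewrite mulseq_cons in Hz *.
by rewrite ny // mulseq_cons; have [] := Hy k kS.
Qed.

Lemma rpoly_scale_inj (R : rcfType) (a b : R) (s s' : seq R) :
  a != 0 -> sorted >%R s -> sorted >%R s' ->
  a *: rpoly s = b *: rpoly s' -> s = s'.
Proof.
move=> a0 ss ss' E; have := congr1 lead_coef E.
rewrite !lead_coefZ !(monicP (rpoly_monic _)) !mulr1 => ab.
by apply: rpoly_inj_sorted => //; apply: (scalerI a0); rewrite E ab.
Qed.

(** At a zero y only (1 - y) times the derivative survives, and 1 - y is positive. *)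
Lemma eulerop_root_sgn (R : rcfType) (b l : R) (s : seq R) (k : nat) :
  sorted >%R s -> (k < size s)%N -> 0 < l -> s`_k <= 0 ->
  0 < (-1) ^+ k * (eulerop b (l *: rpoly s)).[s`_k].
Proof.
move=> ss ks l0 sk; rewrite euleropZ hornerZ eulerop_horner rpoly_nth //.
rewrite mulr0 add0r mulrCA mulr_gt0 // mulrCA mulr_gt0 ?rpoly_deriv_sgn //.
by rewrite subr_gt0 (le_lt_trans sk).
Qed.

Lemma horner_pinfty (R : rcfType) (p : {poly R}) :
  0 < lead_coef p -> exists2 x, 0 < x & 0 < p.[x].
Proof.
move=> lp; have [n Hn] := poly_pinfty_gt_lc lp.
exists (`|n| + 1); first by rewrite ltr_wpDl.
by apply: lt_le_trans lp (Hn _ _); rewrite (le_trans (ler_norm n)) // lerDl.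
Qed.

(** One operator before the end, [q1] has one positive zero and m - 1 negative ones. The last
    operator brings the positive zero to the negative side, and the signs at the zeros [z] of the
    result locate [kap] and [a]. *)
Lemma wquot_roots (R : rcfType) (N b : R) (m : nat) (T a kap : seq R) :
  m%:R < N -> m%:R < b < N -> all (fun c => m%:R < c < N) T ->
  (size T).+1 = m -> mul_roots m T a -> mul_roots m (b :: T) kap ->
  exists z, [/\ size z = m, sorted >%R z, all (fun x => x < 0) z,
    mulseq (wquot N m) m (b :: T) =
      wquot N m m * \prod_(c <- b :: T) (c - m%:R) *: rpoly z &
    (forall k, (k < m)%N -> kap`_k < z`_k) /\
    (forall k, (k.+1 < m)%N -> z`_k.+1 < a`_k)].
Proof.
move=> mN /andP[mb bN] HT sT Ha Hkap.
have HT' : all (fun c => m%:R < c) T by apply: sub_all HT => c /andP[].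
have HbT : all (fun c => m%:R < c) (b :: T) by rewrite /= mb.
set q1 := mulseq (wquot N m) m T; set q0 := mulseq (wquot N m) m (b :: T).
have q0E : q0 = eulerop b q1 by exact: mulseq_cons.
have l1 := wquot_lead_gt0 mN HT'; have l0 := wquot_lead_gt0 mN HbT.
have [sz1 ld1] := mulseq_size_lead (lt0r_neq0 l1).
have [sz0 ld0] := mulseq_size_lead (lt0r_neq0 l0).
have sTm : (size T <= m)%N by rewrite -sT.
have [x [sx xs x0 Hx]] := mulseq_wquot_alternates mN HT sTm.
rewrite -/q1 in Hx sz1 ld1; rewrite -/q0 in sz0 ld0.
have {}Hx k : (k < m)%N -> 0 < (-1) ^+ k.+1 * q1.[x`_k].
  rewrite -{1}sT ltnS => /Hx.
  have -> : (m + size T + k = (size T).*2 + k.+1)%N by rewrite -sT; lia.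
  by rewrite exprD -mul2n exprM expr2 mulrNN mulr1 expr1n mul1r.
(* Together with [X] there are m + 1 alternation points, so all zeros of [q1] are real. *)
have [X X0 q1X] : exists2 X, 0 < X & 0 < q1.[X] by apply: horner_pinfty; rewrite ld1.
have [|||[|k] km|s [ss sos Hs q1E]] := @alternating_roots _ q1 (X :: x) m sz1.
- by rewrite /= sx sT.
- case: x sx xs x0 {Hx} => //= x1 x' _ xs x10; rewrite x10 X0 /=.
  by rewrite x10 in xs.
- exact: ltW.
- by [].
- exact: Hx.
rewrite ld1 in q1E; set l := wquot N m m * _ in ld1 q1E l1.
have s0 : 0 < s`_0 by have := Hs 0; rewrite -{1}sT /= x0 => /(_ isT)/andP[].
have q10 : q1.[0] < 0.
  by have := Hx 0; rewrite -{1}sT x0 expr1 mulN1r oppr_gt0; apply.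
have sneg k : (k.+1 < m)%N -> s`_k.+1 < 0.
  move=> km; have le0 : s`_1 <= 0.
    have := Hs 1; rewrite /= x0 => /(_ (leq_ltn_trans _ km) )/andP[] //.
  have s1 : s`_1 < 0.
    rewrite lt_neqAle le0 andbT; apply/eqP => E; move: q10.
    have := @rpoly_nth _ s 1; rewrite ss E => /(_ (leq_ltn_trans _ km)) r0.
    by rewrite q1E hornerZ r0 ?mulr0 ?ltxx.
  case: k km => // k km; apply: lt_trans s1; apply: sorted_gt_nth; rewrite ?ss //.
case: s ss sos Hs q1E s0 sneg => [|e r] /=; first by rewrite -sT.
move=> ss sos Hs q1E e0 rneg.
have sr : (size r).+1 = m by [].
have sx0 : sorted >%R (0 :: r).
  rewrite /=; case: (r) sos rneg ss => //= r1 r' /andP[_ ->] rneg ss.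
  by rewrite (rneg 0) // -ss.
(* Both [b - N] and [q1.[0]] are negative. Hence [q0] alternates along 0 and the negative zeros of
   [q1]. *)
have q00 : 0 < q0.[0].
  rewrite /q0 mulseq_wquot0 //; last by rewrite -sT.
  by rewrite -/q1 nmulr_rgt0 // subr_lt0.
have [|||k km|z [sz soz Hz q0z]] := @alternating_roots_strict _ q0 (0 :: r) m sz0.
- by rewrite ld0.
- by [].
- exact: sx0.
- case: k km => [|k] km /=; first by rewrite mul1r.
  rewrite q0E q1E; apply: (@eulerop_root_sgn _ b l (e :: r) k.+1) => //=.
    by rewrite ss.
  exact/ltW/rneg.
have zneg : all (fun x => x < 0) z.
  apply/(all_nthP 0) => k; rewrite sz => km; have [+ _] := Hz k km.
  by case: k km => // k km /= /lt_trans; apply; apply: rneg.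
exists z; split=> //; first by rewrite -ld0.
have [skap sokap kapneg KE] := Hkap; have [sa soa aneg aE] := Ha.
have KE' := mulseq_wquot (b :: T) mN; rewrite -/q0 q0z ld0 in KE'.
have sbT : (m - size (b :: T))%N = 0 by rewrite /= sT subnn.
rewrite sbT expr0 mul1r in KE.
have Tm : (m - size T)%N = 1 by rewrite -sT subSnn.
rewrite Tm expr1 in aE.
split.
  have [|||t [st sot Ht tE]] := @alternating_roots_strict _
      (mulseq (wbin R m) m (b :: T)) z m _ _ sz soz.
  - by rewrite KE size_scale ?size_rpoly ?skap /= ?sT // lt0r_neq0 // prod_sub_gt0.
  - by rewrite KE lead_coefZ (monicP (rpoly_monic _)) mulr1 prod_sub_gt0.
  - move=> k km; rewrite -KE'; apply: eulerop_root_sgn; rewrite ?sz //.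
    by apply: ltW; apply: (allP zneg); rewrite mem_nth ?sz.
  suff -> : kap = t by move=> k /Ht[].
  apply: rpoly_scale_inj sokap sot (etrans (esym KE) tE).
  by rewrite lt0r_neq0 // prod_sub_gt0.
set la := \prod_(c <- T) _ in aE.
have la0 : 0 < la by apply: prod_sub_gt0.
(* At a zero of [q0], [eulerop N q1] reduces to [(N - b) *: q1]. It also equals
   [la *: ('X * rpoly a)], where the negative factor from ['X] reverses the sign. *)
have sgz k : (k < m)%N -> 0 < (-1) ^+ k * (rpoly a).[z`_k].
  move=> km; have zk0 : z`_k < 0 by apply: (allP zneg); rewrite mem_nth ?sz.
  have E1 := mulseq_wquot T mN; rewrite -/q1 (eulerop_shift b N) -q0E aE in E1.
  have {}E1 := congr1 (fun p => p.[z`_k]) E1.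
  rewrite /= !(hornerD, hornerZ, hornerM, hornerX) q0z q1E in E1.
  rewrite !hornerZ rpoly_nth ?sz // in E1.
  have sg : 0 < (-1) ^+ k.+1 * (rpoly (e :: r)).[z`_k].
    have [h1 h2] := Hz k km.
    apply: rpoly_sgn_sorted => //=; first by rewrite ss.
      by case: (k) h1 => //= h1 _; apply: lt_trans h1 e0.
    by rewrite ss => km'; exact: h2.
  rewrite mulr0 add0r in E1.
  rewrite -(pmulr_rgt0 _ la0) -(nmulr_rlt0 _ zk0).
  have -> : z`_k * (la * ((-1) ^+ k * (rpoly a).[z`_k])) =
      (-1) ^+ k * (la * (z`_k * (rpoly a).[z`_k])) by ring.
  rewrite -E1 -oppr_gt0.
  have -> : - ((-1) ^+ k * ((N - b) * (l * (rpoly (e :: r)).[z`_k]))) =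
     (N - b) * l * ((-1) ^+ k.+1 * (rpoly (e :: r)).[z`_k]) by rewrite exprS; ring.
  by apply: mulr_gt0 sg; rewrite mulr_gt0 ?subr_gt0.
have m0 : (0 < m)%N by rewrite -sT.
have [||||k /andP[_ km]|t [st sot Ht tE]] := @alternating_roots _ (rpoly a) z (size T).
- by rewrite size_rpoly sa.
- by rewrite sz sT.
- exact: soz.
- by have := sgz _ m0; rewrite mul1r => /ltW.
- by apply: sgz; rewrite -sT ltnS.
have -> : a = t.
  apply: (rpoly_scale_inj (oner_neq0 _) soa sot); rewrite scale1r; exact: tE.
move=> k km; have kT : (k < size T)%N by rewrite -ltnS sT.
by have /andP[] := Ht k kT.
Qed.

(** * Comparison through the derivative *)

Lemma rpoly_cons0 (R : rcfType) (s : seq R) : rpoly (0 :: s) = 'X * rpoly s.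
Proof. by rewrite rpoly_cons polyC0 subr0. Qed.

(** Locates zeros that are already known: the list found from the sign alternations must coincide
    with [s]. *)
Lemma alternating_roots_itv (R : rcfType) (l : R) (s x : seq R) :
  0 < l -> size x = (size s).+1 -> sorted >%R s -> sorted >%R x ->
  (forall k, (k <= size s)%N -> 0 < (-1) ^+ k * (l *: rpoly s).[x`_k]) ->
  forall k, (k < size s)%N -> x`_k.+1 < s`_k < x`_k.
Proof.
move=> l0 sx ss sox Hx k ks.
have {}Hx i : (i <= size s)%N -> 0 < (-1) ^+ i * (rpoly s).[x`_i].
  by move=> /Hx; rewrite hornerZ mulrCA pmulr_rgt0.
have [|i /andP[_ si]|t [st sot Ht tE]] :=
    alternating_roots (size_rpoly s) sx sox.
- by have := Hx 0 (leq0n _); rewrite mul1r => /ltW.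
- exact: Hx.
have st' : s = t.
  by apply: (rpoly_scale_inj (oner_neq0 _) ss sot); rewrite scale1r; exact: tE.
have /andP[h1 h2] := Ht k ks; rewrite -st' in h1 h2.
rewrite h1 lt_neqAle h2 andbT; apply/eqP=> E.
by have := Hx k (ltnW ks); rewrite -E rpoly_nth // mulr0 ltxx.
Qed.

Lemma sorted_gt_cons0 (R : rcfType) (s : seq R) :
  sorted >%R s -> all (fun x => x < 0) s -> sorted >%R (0 :: s).
Proof.
by move=> ss s0; rewrite /= path_sortedE ?ss ?andbT //; exact: rev_trans lt_trans.
Qed.

(** Differentiation lowers k by one, which absorbs the shift of the parameters; the binomial weights
    follow from (k+1) binom(m+1,k+1) = (m+1) binom(m,k). *)
Lemma mulseq_deriv (R : rcfType) (m : nat) (T : seq R) :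
  (mulseq (wbin R m.+1) m.+1 [seq c + 1 | c <- T])^`() =
  m.+1%:R *: mulseq (wbin R m) m T.
Proof.
rewrite /mulseq raddf_sum /= big_ord_recl /= derivZ expr0 derivC scaler0 add0r.
rewrite scaler_sumr; apply: eq_bigr => k _.
rewrite /bump add1n derivZ deriv_exp derivB derivX derivC subr0 mul1r /=.
rewrite -scaler_nat !scalerA /wbin big_map mulrAC mulrA -!natrM.
rewrite [('C(_, _) * _)%N]mulnC -mul_bin_diag; congr (_ * _ *: _).
by apply: eq_bigr => c _; rewrite -natr1; ring.
Qed.

(** The parameter m + 1 kills the top coefficient, and (m+1-k) binom(m+1,k) = (m+1) binom(m,k)
    handles the others. *)
Lemma eulerop_mulseq_top (R : rcfType) (m : nat) (T : seq R) :
  eulerop m.+1%:R (mulseq (wbin R m.+1) m.+1 T) =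
  m.+1%:R *: mulseq (wbin R m) m T.
Proof.
rewrite -mulseq_cons /mulseq big_ord_recr /= big_cons subrr mul0r mulr0 scale0r.
rewrite addr0 scaler_sumr; apply: eq_bigr => k _.
rewrite big_cons scalerA mulrA; congr (_ *: _); rewrite mulrA; congr (_ * _).
have km : (k <= m.+1)%N by apply: ltnW.
by rewrite /wbin -natrB // -!natrM mulnC -mul_bin_down.
Qed.

(* Compare both sides with the degree m - 1 polynomial with parameters [T]:
   it is the derivative of the one and the limit c = m of the other. *)
Lemma mul_roots_wrap (R : rcfType) (m : nat) (c : R) (T a r : seq R) :
  all (fun c => m%:R < c) T -> m%:R < c -> (size T).+1 = m ->
  mul_roots m [seq c + 1 | c <- T] a -> mul_roots m (c :: T) r ->
  forall k, (k.+1 < m)%N -> a`_k < r`_k.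
Proof.
case: m => // m HT Hc [sT] Ha Hr k; rewrite ltnS => km.
have HT' : all (fun c => m%:R < c) T.
  by apply: sub_all HT => d; apply: lt_trans; rewrite ltr_nat.
have HT1 : all (fun c => m.+1%:R < c) [seq c + 1 | c <- T].
  by rewrite all_map; apply: sub_all HT => d /= h; rewrite ltr_wpDr.
(* The degree is now [m.+1], and [eta] lists the zeros of the intermediate polynomial of degree
   [m]. *)
have [eta [seta soeta _ Eeta]] : exists e, mul_roots m T e.
  by apply: mul_roots_exists; rewrite ?sT.
have [s Hs] : exists s, mul_roots m.+1 T s.
  by apply: mul_roots_exists; rewrite ?sT.
have [|r' [Hr' I]] := mul_roots_cons HT Hc _ Hs; first by rewrite sT.
have rE : r' = r by apply: mul_roots_uniq Hr' Hr; rewrite /= Hc.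
rewrite {}rE {Hr'} in I.
have [ss sos sneg Es] := Hs; have [sa soa aneg Ea] := Ha; have [sr sor rneg Er] := Hr.
rewrite size_map sT subSnn expr1 -rpoly_cons0 in Ea.
rewrite sT subSnn expr1 -rpoly_cons0 in Es.
rewrite sT subnn expr0 mul1r in Eeta.
rewrite /= sT subnn expr0 mul1r in Er.
set la := \prod_(_ <- _) _ in Ea; set ls := \prod_(_ <- T) _ in Es.
set le := \prod_(_ <- T) _ in Eeta; set lr := \prod_(_ <- _) _ in Er.
have la0 : 0 < la by apply: prod_sub_gt0.
have ls0 : 0 < ls by apply: prod_sub_gt0.
have le0 : 0 < le by apply: prod_sub_gt0.
have lr0 : 0 < lr by apply: prod_sub_gt0; rewrite /= Hc.
have soa0 := sorted_gt_cons0 soa aneg; have sos0 := sorted_gt_cons0 sos sneg.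
have m0 : 0 < m.+1%:R :> R by rewrite ltr0Sn.
have ks : (k < size eta)%N by rewrite seta sT.
have H1 : a`_k < eta`_k.
  suff /(_ k ks)/andP[] : forall k, (k < size eta)%N ->
      (0 :: a)`_k.+1 < eta`_k < (0 :: a)`_k by [].
  apply: (@alternating_roots_itv _ (m.+1%:R * le)) => //.
  - by rewrite mulr_gt0.
  - by rewrite /= sa size_map seta.
  - move=> i iS; rewrite -scalerA -Eeta -mulseq_deriv Ea derivZ hornerZ mulrCA.
    by rewrite mulr_gt0 // rpoly_deriv_sgn //= sa size_map ltnS -seta.
have /andP[H2 H3] : s`_k < eta`_k < (0 :: s)`_k.
  suff : forall k, (k < size eta)%N -> (0 :: s)`_k.+1 < eta`_k < (0 :: s)`_k.
    by apply.
  apply: (@alternating_roots_itv _ (m.+1%:R * le)) => //.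
  - by rewrite mulr_gt0.
  - by rewrite /= ss seta.
  - move=> i iS; rewrite -scalerA -Eeta -eulerop_mulseq_top Es.
    have is0 : (i < (size s).+1)%N by rewrite ss ltnS -seta.
    apply: eulerop_root_sgn => //; case: (i) is0 => //= j js.
    by apply/ltW/(allP sneg)/mem_nth.
apply: lt_trans H1 _.
set y := eta`_k in H2 H3 *.
(* Writing c = (m+1) + (c-m-1), the operator with parameter m + 1 contributes a polynomial that
   vanishes at [y]. *)
have E : lr * (rpoly r).[y] = (c - m.+1%:R) * ls * (rpoly (0 :: s)).[y].
  have := congr1 (fun p => p.[y]) (mulseq_cons (wbin R m.+1) m.+1 c T).
  rewrite Er (eulerop_shift m.+1%:R c) eulerop_mulseq_top Eeta Es.
  by rewrite !(hornerD, hornerZ) rpoly_nth // !mulr0 add0r -!mulrA.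
have ks0 : (k < size s)%N by rewrite ss sT.
have sg : 0 < (-1) ^+ k.+1 * (rpoly (0 :: s)).[y].
  exact: (@rpoly_sgn_sorted _ (0 :: s) k.+1 y sos0 (ltnW ks0) (fun=> H3) (fun=> H2)).
have neg : (-1) ^+ k * (rpoly r).[y] < 0.
  rewrite -(pmulr_rlt0 _ lr0) mulrCA E -oppr_gt0.
  have -> : - ((-1) ^+ k * ((c - m.+1%:R) * ls * (rpoly (0 :: s)).[y])) =
    (c - m.+1%:R) * ls * ((-1) ^+ k.+1 * (rpoly (0 :: s)).[y]) by rewrite exprS; ring.
  by apply: mulr_gt0 sg; rewrite mulr_gt0 // subr_gt0.
have kr : (k < size r)%N by rewrite sr /= sT ltnS ltnW.
rewrite ltNge; apply/negP; rewrite le_eqVlt => /orP[/eqP ry|ry].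
  by move: neg; rewrite -ry rpoly_nth // mulr0 ltxx.
suff pos : 0 < (-1) ^+ k * (rpoly r).[y] by have := lt_trans pos neg; rewrite ltxx.
apply: rpoly_sgn_sorted => //; first exact: ltnW.
move=> k0; apply: lt_trans H3 _.
have kT : (k.-1 < size T)%N by rewrite sT prednK // ltnW.
by have [_ /(_ kT)] := I k.-1 (ltnW kT); case: (k) k0.
Qed.

(** * The coefficients of the toric g-contribution polynomials *)

Lemma central_bin_rec (r : nat) :
  (r.+1 * 'C(2 * r.+1, r.+1) = 2 * (2 * r).+1 * 'C(2 * r, r))%N.
Proof.
apply/eqP; rewrite -(eqn_pmul2l (ltn0Sn r)); apply/eqP.
have e2 : (2 * r.+1 = (2 * r).+2)%N by lia.
have h1 := mul_bin_diag (2 * r.+1) r; rewrite e2 /= in h1 *.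
have h2 := mul_bin_diag (2 * r).+1 r; rewrite /= in h2.
have h3 : 'C((2 * r).+1, r.+1) = 'C((2 * r).+1, r).
  by rewrite -bin_sub; last lia; congr ('C(_, _)); lia.
rewrite -h1 -h3 mulnCA -h2; lia.
Qed.

Lemma catalan_rec (R : realType) (r : nat) :
  catalan R r.+1 * r.+2%:R = catalan R r * (4 * r%:R + 2).
Proof.
have h : r.+1%:R * ('C(2 * r.+1, r.+1))%:R = (4 * r%:R + 2) * ('C(2 * r, r))%:R :> R.
  by rewrite -natrM central_bin_rec !natrM -[(2 * r).+1%:R]natr1 natrM; ring.
have r1 : r.+1%:R != 0 :> R by rewrite pnatr_eq0.
have r2 : r.+2%:R != 0 :> R by rewrite pnatr_eq0.
rewrite /catalan mulrAC mulVf // mul1r.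
by apply: (mulfI r1); rewrite h !mulrA mulfV // mul1r mulrC.
Qed.

Lemma prod_mkseq (R : rcfType) (f : nat -> R) (N : nat) (x : R) :
  \prod_(c <- mkseq f N) (c - x) = \prod_(l < N) (f l - x).
Proof. by rewrite /mkseq big_map -{1}[N]subn0 -/(index_iota 0 N) big_mkord. Qed.

Definition halves (R : rcfType) (n : nat) (l : nat) : R :=
  n%:R - (n./2)%:R + 2^-1 + l%:R.

(** The last j - 1 of the m - 1 half-integers are raised by 3/2, in place, so that the lists for
    different j compare entry by entry. *)
Definition params (R : rcfType) (n j : nat) : seq R :=
  mkseq (fun l => halves R n l + (if (l < n./2 - j)%N then 0 else 3 / 2)) (n./2).-1.

Lemma central_coef_rec (R : realType) (n k : nat) : (k.+1 <= n./2)%N ->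
  let D k := ('C(2 * (n - k), n - k) * 'C(n - k, k))%:R : R in
  (4 * (n - k)%:R - 2) * k.+1%:R * D k.+1 =
  (n%:R - 2 * k%:R) * (n%:R - 2 * k%:R - 1) * D k.
Proof.
move=> km D.
have [N NE] : exists N, (n - k = N.+1)%N by exists (n - k).-1; lia.
have nE : (n - k.+1 = N)%N by lia.
have kN : (k < N)%N by lia.
have h1 := mul_bin_down N.+1 k; rewrite /= in h1.
have h2 := mul_bin_left N k.
have h3 := central_bin_rec N.
have nR : n%:R = N%:R + 1 + k%:R :> R by rewrite natr1 -natrD; congr (_%:R); lia.
rewrite /D NE nE nR !natrM.
have {}h1 := congr1 (fun x => x%:R : R) h1.
have {}h2 := congr1 (fun x => x%:R : R) h2.
have {}h3 := congr1 (fun x => x%:R : R) h3.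
rewrite /= !natrM natrB in h1; last lia.
rewrite /= !natrM natrB in h2; last lia.
rewrite /= !natrM -[(2 * N).+1%:R]natr1 natrM in h3.
rewrite -[N.+1%:R]natr1 in h1 h3 *; rewrite -[k.+1%:R]natr1 in h2 *.
move: h1 h2 h3; move: ('C(2 * N, N)%:R : R) ('C(2 * N.+1, N.+1)%:R : R) => c c'.
move: ('C(N, k)%:R : R) ('C(N, k.+1)%:R : R) ('C(N.+1, k)%:R : R) => d d1 d'.
move: (N%:R : R) (k%:R : R) => x y h1 h2 h3.
transitivity ((4 * x + 2) * c * ((y + 1) * d1)); first by ring.
transitivity ((x - y) * c' * ((x + 1 - y) * d')); last by ring.
rewrite -h1 h2; transitivity ((x - y) * d * ((x + 1) * c')); last by ring.
by rewrite h3; ring.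
Qed.

(** Passing from k to k + 1 shifts the factors by one place, so only the two extreme ones differ. *)
Lemma prod_shift (R : rcfType) (h : R) (m k : nat) :
  (h + m%:R - 1 - k%:R) * \prod_(l < m) (h + l%:R - k.+1%:R) =
  (h - 1 - k%:R) * \prod_(l < m) (h + l%:R - k%:R).
Proof.
elim: m => [|m IH]; first by rewrite !big_ord0 addr0.
rewrite !big_ord_recr /= [RHS]mulrA -IH -natr1 -[k.+1%:R]natr1; ring.
Qed.

(** Whatever the parity of n, one of n - 2k and n - 2k - 1 is 2(m - k); the other one produces the
    half-integer parameters. *)
Lemma half_natr (R : rcfType) (n k : nat) :
  4 * ((n./2)%:R - k%:R) * (n%:R - (n./2)%:R + 2^-1 - 1 - k%:R) =
  (n%:R - 2 * k%:R) * (n%:R - 2 * k%:R - 1) :> R.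
Proof.
have nE : n%:R = (odd n)%:R + 2 * (n./2)%:R :> R.
  by rewrite -natrM -natrD mul2n odd_double_half.
rewrite nE; case: (odd n); rewrite ?mulr1n ?mulr0n; by field.
Qed.

Lemma halves_gt (R : rcfType) (n l k : nat) :
  (k <= n./2)%N -> (n./2)%:R < halves R n l /\ 0 < halves R n l - k%:R.
Proof.
move=> km; have nm : (n./2)%:R + (n./2)%:R <= n%:R :> R.
  by rewrite -natrD ler_nat addnn -{2}(odd_double_half n) leq_addl.
have kR : k%:R <= (n./2)%:R :> R by rewrite ler_nat.
have l0 := ler0n R l; rewrite /halves; split; lra.
Qed.

(** Both sides have the same ratio of consecutive terms in k, and C is fixed by k = 0. The
    denominator n - k + 1 of the Catalan number is the one in [wquot]. *)
Lemma toric_g0_coef (R : realType) (n : nat) :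
  exists2 C : R, 0 < C & forall k, (k <= n./2)%N ->
    catalan R (n - k) * 'C(n - k, k)%:R =
    C * (wquot n.+1%:R n./2 k * \prod_(c <- mkseq (halves R n) n./2) (c - k%:R)).
Proof.
pose D k := ('C(2 * (n - k), n - k) * 'C(n - k, k))%:R : R.
pose P k := \prod_(l < n./2) (halves R n l - k%:R) : R.
have P0 k : (k <= n./2)%N -> 0 < P k.
  by move=> km; apply: prodr_gt0 => l _; have [] := halves_gt R l km.
have D0 : 0 < D 0%N.
  by rewrite /D ltr0n !subn0 bin0 muln1 bin_gt0 mul2n -addnn leq_addr.
pose C := D 0%N / P 0%N.
have C0 : 0 < C by rewrite divr_gt0 ?P0.
have DE k : (k <= n./2)%N -> D k = C * ('C(n./2, k)%:R * P k).
  elim: k => [|k IH] km; first by rewrite bin0 mul1r divfK ?lt0r_neq0 ?P0.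
  have km' := ltnW km.
  have h1 := central_coef_rec R km.
  rewrite /= -/(D k) -/(D k.+1) (IH km') -half_natr in h1.
  have h2 := prod_shift (n%:R - (n./2)%:R + 2^-1 : R) n./2 k.
  rewrite -/(P k) -/(P k.+1) in h2.
  have h3 : k.+1%:R * 'C(n./2, k.+1)%:R = ((n./2)%:R - k%:R) * 'C(n./2, k)%:R :> R.
    by rewrite -natrB // -!natrM mul_bin_left.
  have nk : (n - k)%:R = n%:R - k%:R :> R by rewrite natrB //; lia.
  have kn : k%:R + 1 <= n%:R :> R by rewrite natr1 ler_nat; lia.
  have X0 : 4 * (n%:R - k%:R) - 2 != 0 :> R by apply: lt0r_neq0; lra.
  have k10 : k.+1%:R != 0 :> R by rewrite pnatr_eq0.
  apply: (mulfI (mulf_neq0 X0 k10)); rewrite -{1}nk h1.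
  transitivity (4 * C * (((n./2)%:R - k%:R) * 'C(n./2, k)%:R) *
     ((n%:R - (n./2)%:R + 2^-1 - 1 - k%:R) * P k)); first by ring.
  by rewrite -h3 -h2; field.
exists C => // k km; rewrite prod_mkseq -/(P k) /catalan /wquot.
have nk : (n.+1%:R - k%:R : R) = (n - k).+1%:R by rewrite -natrB ?subSn //; lia.
rewrite nk -mulrA -natrM -/(D k) DE //.
move: (_^-1) => r; ring.
Qed.

(** The two lists differ only at l = m - j - 1, where n - j - 1/2 becomes n + 1 - j. *)
Lemma prod_params_step (R : rcfType) (n j : nat) (x : R) :
  (0 < j < n./2)%N ->
  (n%:R - j%:R - 2^-1 - x) * \prod_(c <- params R n j.+1) (c - x) =
  (n%:R + 1 - j%:R - x) * \prod_(c <- params R n j) (c - x).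
Proof.
move=> /andP[j0 jm]; rewrite /params !prod_mkseq.
have lt0 : (n./2 - j.+1 < (n./2).-1)%N by lia.
have E : (n./2 - j.+1)%:R = (n./2)%:R - j%:R - 1 :> R.
  by rewrite natrB // -natr1; ring.
pose i0 := Ordinal lt0.
rewrite (bigD1 i0) //= [X in _ = _ * X](bigD1 i0) //= ltnn.
have -> : (n./2 - j.+1 < n./2 - j)%N by lia.
rewrite /halves E; set p := \prod_(i < _ | _) _; set q := \prod_(i < _ | _) _.
have -> : p = q.
  apply: eq_bigr => i ii0; suff -> : (i < n./2 - j.+1)%N = (i < n./2 - j)%N by [].
  have {}ii0 : (i != n./2 - j.+1 :> nat)%N by exact: ii0.
  by rewrite ltn_neqAle; clear -ii0 jm j0; lia.
by field.
Qed.

Lemma toric_g_coef_rec (R : realType) (n j k : nat) :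
  (j < n./2)%N -> (k <= n./2)%N ->
  catalan R (n - k - j.+1) * (4 * (n%:R - j%:R - 2^-1 - k%:R)) =
  catalan R (n - k - j) * (n%:R + 1 - j%:R - k%:R).
Proof.
move=> jm km; have nE := odd_double_half n.
have [r rE] : exists r, (n - k - j = r.+1)%N by exists (n - k - j).-1; lia.
have -> : (n - k - j.+1 = r)%N by lia.
have nR : n%:R = r.+1%:R + k%:R + j%:R :> R by rewrite -!natrD; congr (_%:R); lia.
have h := catalan_rec R r; rewrite rE nR -[r.+1%:R]natr1.
transitivity (catalan R r * (4 * r%:R + 2)); first by field.
by rewrite -h -[r.+2%:R]natr1 -[r.+1%:R]natr1; ring.
Qed.

(** The Catalan recurrence from j = 0 to j = 1 cancels the denominator n + 1 - k and removes the
    largest half-integer, n - 1/2. *)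
Lemma toric_g1_coef (R : realType) (n : nat) : (0 < n./2)%N ->
  exists2 C : R, 0 < C & forall k, (k <= n./2)%N ->
    catalan R (n - k - 1) * 'C(n - k, k)%:R =
    C * (wbin R n./2 k * \prod_(c <- params R n 1) (c - k%:R)).
Proof.
move=> m0; have [C C0 HC] := toric_g0_coef R n.
exists (C / 4); first by rewrite divr_gt0.
move=> k km; have := toric_g_coef_rec R m0 km; rewrite !subn0 subr0 => h.
have kn : k%:R + 1 <= n%:R :> R by rewrite natr1 ler_nat; lia.
have X0 : 4 * (n%:R - 2^-1 - k%:R) != 0 :> R by apply: lt0r_neq0; lra.
have Y0 : n%:R + 1 - k%:R != 0 :> R by apply: lt0r_neq0; lra.
apply: (mulfI X0); rewrite mulrA [_ * catalan _ _]mulrC h mulrAC HC //.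
have -> : \prod_(c <- mkseq (halves R n) n./2) (c - k%:R) =
    (n%:R - 2^-1 - k%:R) * \prod_(c <- params R n 1) (c - k%:R).
  rewrite prod_mkseq /params prod_mkseq.
  have [m mE] : exists m, n./2 = m.+1 by exists (n./2).-1; lia.
  rewrite /halves mE /= big_ord_recr /= mulrC; congr (_ * _).
    by rewrite -natr1; field.
  apply: eq_bigr => i _; rewrite subSS subn0 ltn_ord addr0 //.
rewrite /wquot /wbin -[n.+1%:R]natr1.
by field.
Qed.

Lemma toric_g_coef (R : realType) (n j : nat) : (0 < j <= n./2)%N ->
  exists2 C : R, 0 < C & forall k, (k <= n./2)%N ->
    catalan R (n - k - j) * 'C(n - k, k)%:R =
    C * (wbin R n./2 k * \prod_(c <- params R n j) (c - k%:R)).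
Proof.
elim: j => // -[_ /= m0|j IH /= jm]; first exact: toric_g1_coef.
have [|C C0 HC] := IH; first by rewrite /= ltnW.
exists (C / 4); first by rewrite divr_gt0.
move=> k km; have h := toric_g_coef_rec R jm km.
have kn : j.+1%:R + k%:R + 1 <= n%:R :> R.
  by rewrite -natrD natr1 ler_nat; have := odd_double_half n; lia.
have X0 : 4 * (n%:R - j.+1%:R - 2^-1 - k%:R) != 0 :> R.
  by apply: lt0r_neq0; lra.
apply: (mulfI X0); rewrite mulrA [_ * catalan _ _]mulrC h mulrAC HC //.
have := @prod_params_step R n j.+1 k%:R; rewrite jm => /(_ isT) st.
transitivity (C * wbin R n./2 k * ((n%:R + 1 - j.+1%:R - k%:R) *
   \prod_(c <- params R n j.+1) (c - k%:R))); first by ring.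
by rewrite -st; field.
Qed.

Lemma toric_g0_mulseq (R : realType) (n : nat) :
  exists2 C : R, 0 < C &
    toric_g R n 0 = C *: mulseq (wquot n.+1%:R n./2) n./2 (mkseq (halves R n) n./2).
Proof.
have [C C0 HC] := toric_g0_coef R n; exists C => //.
rewrite /toric_g /mulseq scaler_sumr; apply: eq_bigr => k _.
by rewrite scalerA -HC ?subn0 // -ltnS.
Qed.

Lemma toric_g_mulseq (R : realType) (n j : nat) : (0 < j <= n./2)%N ->
  exists2 C : R, 0 < C &
    toric_g R n j = C *: mulseq (wbin R n./2) n./2 (params R n j).
Proof.
move=> jm; have [C C0 HC] := toric_g_coef R jm; exists C => //.
rewrite /toric_g /mulseq scaler_sumr; apply: eq_bigr => k _.
by rewrite scalerA -HC // -ltnS.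
Qed.

(** * Comparison of the zeros *)

Lemma all2_mkseq (T : Type) (r : rel T) (f g : nat -> T) (N : nat) :
  (forall l, (l < N)%N -> r (f l) (g l)) -> all2 r (mkseq f N) (mkseq g N).
Proof.
move=> H; rewrite all2E !size_mkseq eqxx /mkseq zip_map all_map.
by apply/allP => l; rewrite mem_iota add0n => /H.
Qed.

Lemma params_gt (R : rcfType) (n j : nat) :
  all (fun c => (n./2)%:R < c) (params R n j).
Proof.
rewrite /params all_map; apply/allP => l _ /=.
have [h _] := halves_gt R l (leqnn n./2).
by apply: lt_le_trans h _; rewrite lerDl; case: ifP => _ //; rewrite divr_ge0.
Qed.

Lemma mul_roots_params (R : rcfType) (n j : nat) :
  exists a, mul_roots n./2 (params R n j) a.
Proof. by apply: mul_roots_exists (params_gt _ _ _) _; rewrite size_mkseq leq_pred. Qed.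

Lemma mul_roots_params_mono (R : rcfType) (n i j : nat) (a b : seq R) :
  (0 < i)%N -> (i < j)%N -> (j <= n./2)%N ->
  mul_roots n./2 (params R n i) a -> mul_roots n./2 (params R n j) b ->
  forall k, (k < (n./2).-1)%N -> a`_k < b`_k.
Proof.
move=> i0 ij jm Ha Hb.
have le : all2 <=%R (params R n i) (params R n j).
  apply: all2_mkseq => l _; rewrite lerD2l.
  case: (ltnP l (n./2 - i)) => [_|li]; first by case: ifP => _ //; rewrite divr_ge0.
  suff -> : (l < n./2 - j)%N = false by [].
  by clear -ij li jm; lia.
have sz : size (params R n i) = (n./2).-1 by rewrite size_mkseq.
have [|E|lt1] := @mul_roots_mono _ n./2 [::] _ _ a b (params_gt R n i) le _ Ha Hb.
- by rewrite /= sz leq_pred.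
(* The entry at l = m - j is raised for j but not for i, so the lists are not equal. *)
- have := congr1 (nth 0 ^~ (n./2 - j)%N) E.
  have lm : (n./2 - j < (n./2).-1)%N by clear -ij i0 jm; lia.
  rewrite /= !nth_mkseq // ltnn; have -> : (n./2 - j < n./2 - i)%N by clear -ij jm; lia.
  by move/addrI/eqP; rewrite eq_sym mulf_eq0 invr_eq0 !pnatr_eq0.
by move: lt1; rewrite /= sz.
Qed.

Lemma mul_roots_params_wrap (R : rcfType) (n : nat) (a kap : seq R) :
  (0 < n./2)%N -> mul_roots n./2 (params R n n./2) a ->
  mul_roots n./2 (mkseq (halves R n) n./2) kap ->
  forall k, (k.+1 < n./2)%N -> a`_k < kap`_k.
Proof.
move=> m0 Ha Hkap k km.
(* Adding 1 to the entries n - m + 1 + l of [T] gives the parameters of the polynomial for j = m. *)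
pose T := mkseq (fun l => halves R n l + 2^-1) (n./2).-1.
have aT : all (fun c => (n./2)%:R < c) T.
  rewrite all_map; apply/allP => l _ /=.
  by have [h _] := halves_gt R l (leqnn n./2); rewrite ltr_wpDr // invr_ge0.
have [c0 _] := halves_gt R 0 (leqnn n./2).
have sT : (size T).+1 = n./2 by rewrite size_mkseq prednK.
have TE : [seq c + 1 | c <- T] = params R n n./2.
  rewrite /T /params /mkseq -map_comp; apply: eq_map => l /=.
  by rewrite subnn ltn0 -addrA; congr (_ + _); field.
have aT' : all (fun c => (n./2)%:R < c) ([::] ++ halves R n 0 :: T).
  by rewrite /= c0.
have [r Hr] : exists r, mul_roots n./2 (halves R n 0 :: T) r.
  by apply: mul_roots_exists; rewrite //= sT.
have lt1 := mul_roots_wrap aT c0 sT _ Hr km.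
apply: (lt_le_trans (lt1 a _)); first by rewrite TE.
have le : all2 <=%R (halves R n 0 :: T) (mkseq (halves R n) n./2).
  have -> : mkseq (halves R n) n./2 =
      halves R n 0 :: mkseq (fun l => halves R n l.+1) (n./2).-1.
    by rewrite -[in LHS](prednK m0) /mkseq /= -[1%N]addn0 iotaDl -map_comp.
  rewrite /= lexx; apply: all2_mkseq => l _; rewrite /halves -[l.+1%:R]natr1 addrA lerD2l.
  by rewrite invf_le1 // ler1n.
have [|E|lt2] := mul_roots_mono aT' le _ Hr Hkap; first by rewrite /= sT.
  have -> : r = kap by apply: mul_roots_uniq aT' Hr _; rewrite /= E.
  exact: lexx.
by rewrite ltW // lt2 //= sT ltnW.
Qed.

(** For j > 0 there are only m - 1 operators, so one zero stays at 0; hence strict monotonicity is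
    claimed from index 1 on. *)
Lemma toric_g_roots (R : realType) (n : nat) : (0 < n./2)%N ->
  exists (C : nat -> R) (al : nat -> seq R), [/\
    forall j, (j <= n./2)%N -> [/\ 0 < C j, size (al j) = n./2,
      sorted >%R (al j) & toric_g R n j = C j *: rpoly (al j)],
    all (fun x => x < 0) (al 0%N),
    forall j, (0 < j <= n./2)%N -> (al j)`_0 = 0,
    forall i j k, (i < j <= n./2)%N -> (0 < k < n./2)%N ->
      (al i)`_k < (al j)`_k &
    forall k, (k.+1 < n./2)%N -> (al n./2)`_k.+1 < (al 0%N)`_k].
Proof.
move=> m0; set m := n./2 in m0 *.
have [A sA HA] := @seq_choice _ [::] m.+1 (fun j a => mul_roots m (params R n j) a)
  (fun j _ => mul_roots_params R n j).
have mN : m%:R < n.+1%:R :> R by rewrite ltr_nat /m; have := odd_double_half n; lia.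
have m1 : (0 < 1 <= m)%N by [].
have hE l : (l < m)%N -> m%:R < halves R n l < n.+1%:R.
  move=> lm; have [-> _] := halves_gt R l (leqnn n./2).
  have lmR : l%:R + 1 <= m%:R :> R by rewrite natr1 ler_nat.
  by rewrite /halves -/m -[n.+1%:R]natr1 /=; lra.
have a1 : all (fun c => m%:R < c < n.+1%:R) (params R n 1).
  rewrite all_map; apply/allP => l; rewrite mem_iota add0n /= -/m => lm.
  by rewrite subn1 lm addr0 hE // (leq_trans lm) // leq_pred.
have s1 : (size (params R n 1)).+1 = m by rewrite size_mkseq prednK.
(* The largest half-integer, n - 1/2, goes to the front; what remains is the list for j = 1, as
   [wquot_roots] requires. *)
have pE : perm_eq (halves R n m.-1 :: params R n 1) (mkseq (halves R n) m).
  rewrite -[in mkseq _ m](prednK m0) mkseqS perm_sym perm_rcons perm_cons.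
  suff -> : params R n 1 = mkseq (halves R n) m.-1 by [].
  apply/(@eq_from_nth _ 0) => [|l]; rewrite !size_mkseq // => lm.
  by rewrite !nth_mkseq // -/m subn1 lm addr0.
have apar j : all (fun c => m%:R < c) (params R n j) by exact: params_gt.
have HA1 : mul_roots m (params R n 1) (nth [::] A 1) by apply: HA.
have hb := hE m.-1 _; rewrite prednK // in hb; have {}hb := hb (leqnn _).
have abk : all (fun c => m%:R < c) (halves R n m.-1 :: params R n 1).
  by apply/andP; split; [case/andP: hb|exact: apar].
have [kap Hkap] : exists kap, mul_roots m (halves R n m.-1 :: params R n 1) kap.
  by apply: mul_roots_exists abk _; rewrite /= s1.
have [z [sz soz zneg zE [kapz za]]] := wquot_roots mN hb a1 s1 HA1 Hkap.
pose al j := if j is 0 then z else 0 :: nth [::] A j.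
exists (fun j => lead_coef (toric_g R n j)), al.
have sA' j : (0 < j <= m)%N -> size (nth [::] A j) = m.-1.
  by move=> /andP[_ jm]; have [-> _ _ _] := HA _ jm; rewrite size_mkseq.
have Az k : (k.+1 < m)%N -> (nth [::] A m)`_k < z`_k.
  move=> km; apply: lt_trans (kapz k (ltnW km)).
  by apply: (mul_roots_params_wrap m0 (HA m (leqnn _))) => //; apply: mul_roots_perm Hkap.
have Amono i j k : (0 < i)%N -> (i < j <= m)%N -> (k < m.-1)%N ->
    (nth [::] A i)`_k < (nth [::] A j)`_k.
  move=> i0 /andP[ij jm]; apply: (mul_roots_params_mono i0 ij jm).
    by apply: HA; rewrite ltnS (leq_trans (ltnW ij)).
  exact: HA.
have leadE (c : R) s p : p = c *: rpoly s -> 0 < c -> 0 < lead_coef p /\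
    p = lead_coef p *: rpoly s.
  by move=> -> c0; rewrite lead_coefZ (monicP (rpoly_monic s)) mulr1.
split=> //.
- case=> [_|j jm].
    have [C C0 gE] := toric_g0_mulseq R n.
    have [||g0 gE'] := leadE (C * (wquot n.+1%:R m m *
      \prod_(c <- halves R n m.-1 :: params R n 1) (c - m%:R))) z (toric_g R n 0).
    + by rewrite gE -scalerA -zE (mulseq_perm _ _ pE).
    + by rewrite mulr_gt0 // wquot_lead_gt0.
    by split.
  have [C C0 gE] := @toric_g_mulseq R n j.+1 jm.
  have [s1' so1 neg1 E1] := HA j.+1 jm.
  have e1 : (m - size (params R n j.+1))%N = 1 by rewrite size_mkseq -/m; clear -m0; lia.
  rewrite e1 expr1 -rpoly_cons0 in E1.
  have [||g0 gE'] := leadE (C * \prod_(c <- params R n j.+1) (c - m%:R))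
    (al j.+1) (toric_g R n j.+1).
  + by rewrite gE E1 scalerA.
  + by rewrite mulr_gt0 // prod_sub_gt0.
  split=> //; last exact: sorted_gt_cons0.
  by rewrite /= sA' // prednK.
- by case.
- case=> [|i] [|j] // k ijm /andP[k0 km]; case: k k0 km => // k _ km /=.
    have [->|j0] := posnP j; first exact: za.
    have k' : (k < m.-1)%N by rewrite -ltnS prednK.
    by apply: lt_trans (za _ km) (Amono 1 j.+1 k _ _ k'); rewrite // ltnS j0.
  by apply: Amono; rewrite // -ltnS prednK.
by rewrite /al; case: (m) m0 Az => // m' _ Az k km /=; apply: Az.
Qed.

(** * Interlacing and nonnegative combinations *)

Lemma real_rooted_rpoly (R : realType) (c : R) (s : seq R) :
  c != 0 -> real_rooted (c *: rpoly s).
Proof.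
move=> c0 z; rewrite map_polyZ rootZ; last first.
  by rewrite -[0](rmorph0 (real_complex R)) (inj_eq (fmorph_inj _)).
rewrite /rpoly rmorph_prod /=; under eq_bigr => x _ do rewrite map_polyXsubC.
rewrite -(big_map (real_complex R) xpredT (fun y => 'X - y%:P)) root_prod_XsubC.
by move=> /mapP[x _ ->].
Qed.

Lemma zero_list_rpoly (R : realType) (c : R) (s : seq R) :
  c != 0 -> sorted >%R s -> zero_list (c *: rpoly s) s.
Proof.
move=> c0 ss; split; first by apply: sub_sorted ss => x y; apply: ltW.
by move=> x; rewrite -mul_polyC mupMr ?rootC // mu_prod_XsubC.
Qed.

Lemma interlaces_rpoly (R : realType) (c d : R) (a b : seq R) :
  0 < c -> 0 < d -> sorted >%R a -> sorted >%R b ->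
  size b = size a \/ size b = (size a).+1 ->
  (forall i, (i < size a)%N -> a`_i <= b`_i) ->
  (forall i, (i < size a)%N -> (i.+1 < size b)%N -> b`_i.+1 <= a`_i) ->
  interlaces (c *: rpoly a) (d *: rpoly b).
Proof.
move=> c0 d0 sa sb sab h1 h2.
split; rewrite ?lead_coefZ ?(monicP (rpoly_monic _)) ?mulr1 //.
- exact/real_rooted_rpoly/lt0r_neq0.
- exact/real_rooted_rpoly/lt0r_neq0.
by exists a, b; split=> //; apply: zero_list_rpoly => //; apply: lt0r_neq0.
Qed.

(* At the zeros of the last polynomial, apart from the largest one, all the
   others have strictly alternating signs, and so does any combination that
   involves one of them. *)
Lemma real_rooted_cone (R : realType) (m : nat) (C lam : nat -> R)
    (al : nat -> seq R) (f : {poly R}) :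
  (forall j, (j <= m)%N -> [/\ 0 < C j, size (al j) = m & sorted >%R (al j)]) ->
  (forall j, (j <= m)%N -> 0 <= (C j *: rpoly (al j)).[(al m)`_0]) ->
  (forall j k, (j < m)%N -> (0 < k < m)%N ->
     0 < (-1) ^+ k * (C j *: rpoly (al j)).[(al m)`_k]) ->
  (forall j, 0 <= lam j) ->
  f = \sum_(j < m.+1) lam j *: (C j *: rpoly (al j)) -> f != 0 ->
  real_rooted f.
Proof.
move=> H H0 Hk l0 fE f0.
have [Cm sm som] := H m (leqnn _).
(* Strict signs need a positive weight at some index below m; otherwise [f] is a multiple of the
   last polynomial. *)
have [j /andP[jm lj]|no] :=
  pickP (fun j : 'I_m.+1 => (j < m)%N && (0 < lam j)); last first.
  have {}fE : f = (lam m * C m) *: rpoly (al m).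
    rewrite fE big_ord_recr /= big1 ?add0r ?scalerA // => i _.
    have := no (widen_ord (leqnSn m) i); rewrite /= ltn_ord /= => /negbT.
    rewrite -leNgt => h; rewrite (_ : lam i = 0) ?scale0r //.
    by apply/le_anti; rewrite h l0.
  rewrite fE; apply: real_rooted_rpoly; apply: contraNneq f0 => E.
  by rewrite fE E scale0r.
have coef0 (i : 'I_m.+1) : (lam i *: (C i *: rpoly (al i)))`_m = lam i * C i.
  have [_ si _] := H i (ltn_ord i).
  have := monicP (rpoly_monic (al i)); rewrite lead_coefE size_rpoly si /= => E.
  by rewrite !coefZ E mulr1.
have fm : 0 < f`_m.
  rewrite fE coef_sum (bigD1 j) //= coef0 ltr_pwDl //.
    by rewrite mulr_gt0 //; have [] := H j (ltn_ord j).
  apply: sumr_ge0 => i _; rewrite coef0 mulr_ge0 //.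
  by have [/ltW] := H i (ltn_ord i).
have szf : size f = m.+1.
  apply/eqP; rewrite eqn_leq; apply/andP; split.
    rewrite fE; apply: (leq_trans (size_sum _ _ _)); apply/bigmax_leqP => i _.
    do 2 apply: leq_trans (size_scale_leq _ _) _.
    by rewrite size_rpoly; have [_ -> _] := H i (ltn_ord i).
  by rewrite ltnNge; apply/negP => /(nth_default 0) E; rewrite E ltxx in fm.
have ldf : 0 < lead_coef f by rewrite lead_coefE szf.
have fx x : f.[x] = \sum_(i < m.+1) lam i * (C i *: rpoly (al i)).[x].
  by rewrite fE horner_sum; apply: eq_bigr => i _; rewrite hornerZ.
have [|k km|s [_ _ _ ->]] := alternating_roots_minfty szf ldf sm som.
- by move=> _; rewrite fx; apply: sumr_ge0 => i _; rewrite mulr_ge0 // H0 // -ltnS.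
- rewrite fx mulr_sumr (bigD1 j) //= ltr_pwDl //.
    by rewrite mulrCA mulr_gt0 // Hk.
  apply: sumr_ge0 => i _; rewrite mulrCA mulr_ge0 //.
  have := ltn_ord i; rewrite ltnS leq_eqVlt => /orP[/eqP->|im]; last by rewrite ltW // Hk.
  by rewrite hornerZ rpoly_nth ?sm ?mulr0 // (andP km).2.
exact/real_rooted_rpoly/lt0r_neq0.
Qed.

Theorem theorem8p1 (R : realType) (n : nat) (n_ge2 : (2 <= n)%N) :
  let m := n./2 in
  let g := toric_g R n in
  [/\ (* g_(n,m) / t is a polynomial of degree m - 1 *)
      'X %| g m /\ size (g m %/ 'X) = m.-1.+1,
      (forall j, (j <= m)%N -> interlaces (g m %/ 'X) (g j)),
      interlacing_sequence (mkseq g m.+1) &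
      (forall lam : 'I_m.+1 -> R, (forall j, 0 <= lam j) ->
         \sum_(j < m.+1) lam j *: g j != 0 ->
         real_rooted (\sum_(j < m.+1) lam j *: g j))].
Proof.
move=> m g.
have m0 : (0 < m)%N by rewrite /m; have := odd_double_half n; lia.
have [C [al [H al0 alj mono wrap]]] := toric_g_roots R m0.
rewrite -/m in H al0 alj mono wrap.
have [Cm sm som gm] := H m (leqnn _).
have monoW i j k : (i <= j <= m)%N -> (k < m)%N -> (al i)`_k <= (al j)`_k.
  move=> /andP[]; rewrite leq_eqVlt => /orP[/eqP->//|ij] jm; case: k => [|k] km.
    have {}ijm : (0 < j <= m)%N by rewrite jm (leq_ltn_trans _ ij).
    have [i0|i0] := posnP i.
      rewrite i0 (alj j) // ltW // (allP al0) // mem_nth //.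
      by have [_ -> _ _] := H 0%N (leq0n _).
    by rewrite !alj // i0 (leq_trans (ltnW ij)).
  by rewrite ltW // mono // ij.
(* Chain from j up to m, wrap around from m to 0 at the cost of one index, then up to i. *)
have wrapW i j k : (i <= m)%N -> (j <= m)%N -> (k.+1 < m)%N ->
    (al j)`_k.+1 < (al i)`_k.
  move=> im jm km; apply: le_lt_trans (lt_le_trans (wrap k km) _).
    by apply: monoW; rewrite // jm leqnn.
  by apply: monoW; rewrite ?im // ltnW.
have am0 : (al m)`_0 = 0 by apply: alj; rewrite m0 leqnn.
(* Dividing by t drops the zero 0 from the head of the list. *)
pose h := behead (al m).
have alE : al m = 0 :: h.
  by rewrite /h; case: (al m) sm am0 => [/esym/eqP|x s _ /= ->//]; rewrite (gtn_eqF m0).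
have sh : (size h).+1 = m by rewrite -sm alE.
have gmE : g m = 'X * (C m *: rpoly h) by rewrite /g gm alE rpoly_cons0 scalerAr.
have gmX : g m %/ 'X = C m *: rpoly h by rewrite gmE mulKp ?polyX_eq0.
have soh : sorted >%R h by move: som; rewrite alE => /path_sorted.
have hE k : h`_k = (al m)`_k.+1 by rewrite alE.
split.
- split; first by rewrite gmE dvdp_mulIl.
  by rewrite gmX size_scale ?lt0r_neq0 // size_rpoly sh prednK.
- move=> j jm; have [Cj sj soj gj] := H j jm; rewrite gmX /g gj.
  apply: interlaces_rpoly => //; first by right; rewrite sj sh.
    move=> i; rewrite -ltnS sh hE => im; exact/ltW/wrapW.
  move=> i; rewrite -ltnS sh hE => im _; apply: monoW => //.
  by rewrite jm leqnn.
- move=> i j ij; rewrite size_mkseq ltnS => jm.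
  have im : (i <= m)%N by apply: leq_trans jm; apply: ltnW.
  rewrite !nth_mkseq ?ltnS //.
  have [Ci si soi gi] := H i im; have [Cj sj soj gj] := H j jm; rewrite /g gi gj.
  apply: interlaces_rpoly => //; first by left; rewrite sj si.
    by move=> k; rewrite si => km; apply: monoW; rewrite // jm ltnW.
  by move=> k _; rewrite sj => km; apply/ltW/wrapW.
move=> lam lam0 f0.
(* The weights are extended by 0 to all natural numbers, as [real_rooted_cone] expects. *)
pose lam' j := if insub j is Some i then lam i else 0.
apply: (@real_rooted_cone R m C lam' al _ _ _ _ _ _ f0).
- by move=> j jm; have [] := H j jm.
- move=> j jm; rewrite am0 hornerZ; have [Cj sj soj _] := H j jm.
  (* At t = 0 the polynomials with j > 0 vanish, and the one with j = 0 is positive because its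
     zeros are negative. *)
  case: (posnP j) jm sj Cj => [-> _ s0 C0|j0 jm sj Cj]; last first.
    by rewrite -(alj j) ?j0 // rpoly_nth ?mulr0 ?sj // alj ?j0.
  rewrite mulr_ge0 ?(ltW C0) //.
  have := @rpoly_sgn _ (al 0%N) 0 0 isT; rewrite mul1r => pos.
  apply/ltW/pos => // i /= si.
  by apply: (allP al0); rewrite mem_nth.
- move=> j k jm /andP[k0 km]; have [Cj sj soj _] := H j (ltnW jm).
  rewrite hornerZ mulrCA mulr_gt0 //; apply: rpoly_sgn_sorted => //.
  + by rewrite sj ltnW.
  + by move=> _; case: k k0 km => // k _ km; apply: wrapW => //; apply: ltnW.
  + by move=> _; apply: mono; rewrite ?k0 // jm leqnn.
- by move=> j; rewrite /lam'; case: insubP.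
apply: eq_bigr => i _; rewrite /lam' valK; congr (_ *: _).
by have [_ _ _ <-] := H i (leq_ord i).
Qed.
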